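(* \begin{enumerate} \item If $V\in \mathbf{Mod}(\operatorname{Alt}(5),2,2)$ is faithful, then, viewing $\operatorname{Alt}(5)$ as $\operatorname{SL}(2,\mathbb F_4)$, $V\cong \operatorname{Nat}(2,L)$ as $\operatorname{Alt}(5)$-modules for some $1$-dimensional subgroup $L\le V$ (which carries an $\mathbb F_4$-vector space structure). \item If $V\in \mathbf{Mod}(\operatorname{Alt}(5),3,5)$ is faithful, then, viewing $\operatorname{Alt}(5)$ as $\operatorname{PSL}(2,\mathbb F_5)$, $V\cong \operatorname{Ad}(2,L)$ as $\operatorname{Alt}(5)$-modules for some $1$-dimensional subgroup $L\le V$ (which is an $\mathbb F_5$-vector space). \item If $V\in \mathbf{Mod}(\operatorname{Alt}(6),3,3)$ is faithful, then, viewing $\operatorname{Alt}(6)$ as $\operatorname{PSL}(2,\mathbb F_9)$, $V\cong \operatorname{Ad}(2,L)$ as $\operatorname{Alt}(6)$-modules for some $1$-dimensional subgroup $L\le V$ (which carries an $\mathbb F_9$-vector space structure). \end{enumerate}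
   Context: A modular universe $\mathcal{U}$ is a collection $\mathrm{Ob}(\mathcal U)$ of abelian groups (the modules of $\mathcal U$) together with a collection $\mathrm{Ar}(\mathcal U)$ of group homomorphisms between them (the compatible morphisms), closed under composition, with the following closure properties. (Inverses) If $f\in \mathrm{Ar}(\mathcal U)$ is an isomorphism, then $f^{-1}\in \mathrm{Ar}(\mathcal U)$. (Products) If $V_1,V_2\in \mathrm{Ob}(\mathcal U)$ and $f_1,f_2\in\mathrm{Ar}(\mathcal U)$, then $V_1\times V_2\in\mathrm{Ob}(\mathcal U)$, and $\mathrm{Ar}(\mathcal U)$ contains $f_1\times f_2$, the projections $V_1\times V_2\to V_i$, and the diagonal embeddings $V_1\to V_1^k$. (Sections) If $W\le V$ are in $\mathrm{Ob}(\mathcal U)$, then $V/W\in\mathrm{Ob}(\mathcal U)$ and $\mathrm{Ar}(\mathcal U)$ contains the inclusion $W\to V$ and the quotient map $V\to V/W$. (Kernels/images) If $f:V_1\to V_2$ is in $\mathrm{Ar}(\mathcal U)$, then $\ker f,\operatorname{im} f\in\mathrm{Ob}(\mathcal U)$, and for all $W_1,W_2\in\mathrm{Ob}(\mathcal U)$: if $W_1\le\ker f$, the induced map $V_1/W_1\to V_2$ is in $\mathrm{Ar}(\mathcal U)$; if $\operatorname{im} f\le W_2\le V_2$, the induced map $V_1\to W_2$ is in $\mathrm{Ar}(\mathcal U)$. ($\mathbb Z$-module structure) If $V\in\mathrm{Ob}(\mathcal U)$, then $\mathrm{Ar}(\mathcal U)$ contains the sum map $V\times V\to V$ and the multiplication-by-$n$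 maps $V\to V$ for $n\in\mathbb{Z}$. An additive dimension on $\mathcal U$ is a function $\dim:\mathrm{Ob}(\mathcal U)\to\mathbb N$ such that $\dim V=\dim\ker f+\dim\operatorname{im} f$ for every $f:V\to W$ in $\mathrm{Ar}(\mathcal U)$. A $G$-module in $\mathcal U$ is a module $V\in\mathrm{Ob}(\mathcal U)$ with an action of the group $G$ by compatible morphisms. Submodules of $V$ are subgroups of $V$ belonging to $\mathrm{Ob}(\mathcal U)$; a $1$-dimensional subgroup $L\le V$ is a submodule with $\dim L=1$. A module $V$ is dim-connected if every proper submodule $W<V$ in $\mathcal U$ satisfies $\dim W<\dim V$. For a prime $p$, $\mathbf{Mod}(G,d,p)$ is the class of all dim-connected $G$-modules of dimension exactly $d$ and of characteristic $p$ (i.e. elementary abelian $p$-groups), in modular universes with an additive dimension (each module coming with its own universe). For a field $F$: $\operatorname{Nat}(n,F)=F^n$ is the natural $\operatorname{SL}(n,F)$-module (matrix multiplication), and $\operatorname{Ad}(n,F)$ is the group of $n\times n$ matrices over $F$ of trace $0$, viewed as a $\operatorname{PSL}(n,F)$-module by conjugation. If $L$ is any vector space over $F$, then $\operatorname{Nat}(n,L)=\operatorname{Nat}(n,F)\otimes_F L$ and $\operatorname{Ad}(n,L)=\operatorname{Ad}(n,F)\otimes_F L$, with $G$ acting trivially on $L$. In (1), (2), (3) the field is $F=\mathbb F_4,\mathbb F_5,\mathbb F_9$ respectively, and one uses the exceptional isomorphisms $\operatorname{Alt}(5)\cong\operatorname{SL}(2,\mathbb F_4)$, $\operatorname{Alt}(5)\cong\operatorname{PSL}(2,\mathbb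 F_5)$, $\operatorname{Alt}(6)\cong\operatorname{PSL}(2,\mathbb F_9)$. *)

(* Defs.v *)
From HB Require Import structures.
From mathcomp Require Import all_boot all_order all_algebra.
From mathcomp Require Import all_fingroup all_solvable.
From mathcomp Require Import generic_quotient ring_quotient.
From mathcomp Require Import boolp.
From mathcomp.multinomials Require Import freeg.

Set Implicit Arguments.
Unset Strict Implicit.
Unset Printing Implicit Defensive.

Import GRing.Theory.
Local Open Scope ring_scope.
Local Open Scope quotient_scope.

(* A subgroup of V is a boolean predicate closed under 0 and subtraction;
   classically these are all the subgroups of V. *)
Definition subgrp (V : zmodType) (S : zmodClosed V) : Type := {x : V | x \in S}.

HB.instance Definition _ (V : zmodType) (S : zmodClosed V) :=
  SubChoice.on (subgrp S).
HB.instance Definition _ (V : zmodType) (S : zmodClosed V) :=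
  [SubChoice_isSubZmodule of subgrp S by <:].

Notation quotgrp := Quotient.quot.

Section KernelImage.
Variables (V W : zmodType) (f : {additive V -> W}).

Definition addker_pred : pred V := [pred x | f x == 0].

Lemma addker_closed : zmod_closed addker_pred.
Proof.
split=> [|x y]; rewrite !inE ?raddf0 // => /eqP fx /eqP fy.
by rewrite raddfB fx fy subrr.
Qed.
HB.instance Definition _ := GRing.isZmodClosed.Build V addker_pred addker_closed.

Definition addker : zmodClosed V := GRing.ZmodClosed.clone V addker_pred _.

Definition addim_pred : pred W := [pred y | `[< exists x, f x = y >]].

Lemma addim_closed : zmod_closed addim_pred.
Proof.
split=> [|x y]; rewrite !inE; first by apply/asboolP; exists 0; rewrite raddf0.
move=> /asboolP[a <-] /asboolP[b <-].
by apply/asboolP; exists (a - b); rewrite raddfB.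
Qed.
HB.instance Definition _ := GRing.isZmodClosed.Build W addim_pred addim_closed.

Definition addim : zmodClosed W := GRing.ZmodClosed.clone W addim_pred _.

Lemma addkerP x : (x \in addker) = (f x == 0).
Proof. by []. Qed.

Lemma addimP y : reflect (exists x, f x = y) (y \in addim).
Proof. exact: asboolP. Qed.
End KernelImage.

(* powgrp V k is the power V^(k+1), as an iterated binary product. *)
Fixpoint powgrp (V : zmodType) (k : nat) : zmodType :=
  if k is k'.+1 then (V * powgrp V k')%type else V.

Fixpoint diagonal (V : zmodType) (k : nat) (x : V) : powgrp V k :=
  if k is k'.+1 return powgrp V k then (x, diagonal k' x) else x.

(* A subgroup S <= V belongs to the universe when the group subgrp S does.
   A subgroup of a subgroup of V is not literally a subgroup of V, but the
   closure properties make the canonical isomorphism between the two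
   presentations compatible in both directions. *)
Record modular_universe := ModularUniverse {
  Ob : zmodType -> Prop;
  Ar : forall V W : zmodType, (V -> W) -> Prop;

  Ar_hom : forall (V W : zmodType) (f : V -> W), Ar f ->
    [/\ Ob V, Ob W & zmod_morphism f];
  Ar_comp : forall (V1 V2 V3 : zmodType) (g : V2 -> V3) (f : V1 -> V2),
    Ar g -> Ar f -> Ar (g \o f);

  Ar_inv : forall (V W : zmodType) (f : V -> W) (g : W -> V),
    cancel f g -> cancel g f -> Ar f -> Ar g;

  Ob_prod : forall V1 V2 : zmodType, Ob V1 -> Ob V2 -> Ob (V1 * V2)%type;
  Ar_prod : forall (V1 V2 W1 W2 : zmodType) (f1 : V1 -> W1) (f2 : V2 -> W2),
    Ar f1 -> Ar f2 -> Ar (fun x : V1 * V2 => (f1 x.1, f2 x.2));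
  Ar_fst : forall V1 V2 : zmodType, Ob V1 -> Ob V2 -> Ar (@fst V1 V2);
  Ar_snd : forall V1 V2 : zmodType, Ob V1 -> Ob V2 -> Ar (@snd V1 V2);
  Ar_diag : forall (V : zmodType) (k : nat), Ob V -> Ar (@diagonal V k);

  Ob_quot : forall (V : zmodType) (W : zmodClosed V),
    Ob V -> Ob (subgrp W) -> Ob (quotgrp W);
  Ar_incl : forall (V : zmodType) (W : zmodClosed V),
    Ob V -> Ob (subgrp W) -> Ar (val : subgrp W -> V);
  Ar_pi : forall (V : zmodType) (W : zmodClosed V),
    Ob V -> Ob (subgrp W) -> Ar (\pi_(quotgrp W) : V -> quotgrp W);

  Ob_ker : forall (V1 V2 : zmodType) (f : {additive V1 -> V2}),
    Ar f -> Ob (subgrp (addker f));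
  Ob_im : forall (V1 V2 : zmodType) (f : {additive V1 -> V2}),
    Ar f -> Ob (subgrp (addim f));
  (* The equations on g say that it is the map induced by f. *)
  Ar_induced_quot : forall (V1 V2 : zmodType) (f : {additive V1 -> V2})
      (W1 : zmodClosed V1) (g : quotgrp W1 -> V2),
    Ar f -> Ob (subgrp W1) -> {subset W1 <= addker f} ->
    (forall x : V1, g (\pi_(quotgrp W1) x) = f x) -> Ar g;
  Ar_induced_sub : forall (V1 V2 : zmodType) (f : {additive V1 -> V2})
      (W2 : zmodClosed V2) (g : V1 -> subgrp W2),
    Ar f -> Ob (subgrp W2) -> {subset addim f <= W2} ->
    (forall x : V1, val (g x) = f x) -> Ar g;

  Ar_sum : forall V : zmodType, Ob V -> Ar (fun x : V * V => x.1 + x.2);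
  Ar_mulz : forall (V : zmodType) (n : int), Ob V -> Ar (fun x : V => x *~ n)
}.

(* The value of dim outside Ob U is irrelevant. *)
Record additive_dimension (U : modular_universe) := AdditiveDimension {
  dim :> zmodType -> nat;
  dim_additive : forall (V W : zmodType) (f : {additive V -> W}), Ar U f ->
    dim V = (dim (subgrp (addker f)) + dim (subgrp (addim f)))%N
}.

Definition dim_connected (U : modular_universe) (dim : additive_dimension U)
    (V : zmodType) : Prop :=
  forall W : zmodClosed V, Ob U (subgrp W) -> (exists x, x \notin W) ->
    (dim (subgrp W) < dim V)%N.

Section GModules.
Local Open Scope group_scope.

(* Only the restriction of rho to G is meaningful. *)
Definition is_action (gT : finGroupType) (G : {group gT}) (V : zmodType)
    (rho : gT -> {additive V -> V}) : Prop :=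
  (forall v, rho 1 v = v) /\
  {in G &, forall g h v, rho (g * h) v = rho g (rho h v)}.

(* The class Mod(G, d, p): each member comes with its own universe and
   additive dimension. *)
Record Mod (gT : finGroupType) (G : {group gT}) (d p : nat) := MkMod {
  univ : modular_universe;
  udim : additive_dimension univ;
  mcarrier :> zmodType;
  mod_act : gT -> {additive mcarrier -> mcarrier};
  mcarrier_Ob : Ob univ mcarrier;
  mod_act_action : is_action G mod_act;
  mod_act_Ar : {in G, forall g, Ar univ (mod_act g)};
  mod_dim : udim mcarrier = d;
  mod_connected : dim_connected udim mcarrier;
  mod_char : forall v : mcarrier, (v *+ p = 0)%R
}.

Definition faithful_module (gT : finGroupType) (G : {group gT}) (d p : nat)
    (V : Mod G d p) : Prop :=
  {in G, forall g, (forall v : V, mod_act V g v = v) -> g = 1}.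

(* psi is not required to be a compatible morphism: W = Nat(n, L) or Ad(n, L)
   is not given as a module of the universe of V. *)
Definition gmod_iso (gT : finGroupType) (G : {group gT}) (V W : zmodType)
    (rho : gT -> {additive V -> V}) (sigma : gT -> {additive W -> W}) : Prop :=
  exists2 psi : {additive V -> W}, bijective psi &
    {in G, forall g v, psi (rho g v) = sigma g (psi v)}.

End GModules.

(* The tensor product of M and L over F is the free abelian group on M * L
   modulo the subgroup generated by the usual relations. *)
Section Tensor.
Variables (F : fieldType) (M L : lmodType F).

Definition tgen (m : M) (l : L) : {freeg (M * L)%type} := << (m, l) >>.

Definition tensor_relations (S : {pred {freeg (M * L)%type}}) : Prop :=
  [/\ forall m m' l, tgen (m + m') l - tgen m l - tgen m' l \in S,
      forall m l l', tgen m (l + l') - tgen m l - tgen m l' \in S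
    & forall a m l, tgen (a *: m) l - tgen m (a *: l) \in S].

Definition tensor_ker_pred : pred {freeg (M * L)%type} :=
  [pred D | `[< forall S : zmodClosed {freeg (M * L)%type},
                 tensor_relations S -> D \in S >]].

Lemma tensor_ker_closed : zmod_closed tensor_ker_pred.
Proof.
split=> [|x y]; rewrite !inE; first by apply/asboolP => S _; rewrite rpred0.
move=> /asboolP hx /asboolP hy; apply/asboolP => S hS.
by rewrite rpredB ?hx ?hy.
Qed.
HB.instance Definition _ :=
  GRing.isZmodClosed.Build {freeg (M * L)%type} tensor_ker_pred tensor_ker_closed.

Definition tensor_ker : zmodClosed {freeg (M * L)%type} :=
  GRing.ZmodClosed.clone {freeg (M * L)%type} tensor_ker_pred _.

Definition tensor : zmodType := quotgrp tensor_ker.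

Definition pure (m : M) (l : L) : tensor := \pi_(quotgrp tensor_ker) (tgen m l).

Lemma tensor_ker_relations : tensor_relations tensor_ker.
Proof.
by split=> *; apply/asboolP => S [h1 h2 h3];
  [apply: h1 | apply: h2 | apply: h3].
Qed.

Lemma pureDl m m' l : pure (m + m') l = pure m l + pure m' l.
Proof.
have [h _ _] := tensor_ker_relations; apply/eqP.
rewrite /pure -[X in _ == X]raddfD -Quotient.idealrBE opprD addrA; exact: h.
Qed.

Lemma pureDr m l l' : pure m (l + l') = pure m l + pure m l'.
Proof.
have [_ h _] := tensor_ker_relations; apply/eqP.
rewrite /pure -[X in _ == X]raddfD -Quotient.idealrBE opprD addrA; exact: h.
Qed.

Lemma pureZ a m l : pure (a *: m) l = pure m (a *: l).
Proof.
have [_ _ h] := tensor_ker_relations; apply/eqP.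
rewrite /pure -Quotient.idealrBE; exact: h.
Qed.

End Tensor.

Section TensorMap.
Variables (F : fieldType) (M L : lmodType F) (f : {linear M -> M}).

Definition pre_map (D : {freeg (M * L)%type}) : tensor M L :=
  fglift (fun p : M * L => pure (f p.1) p.2 : zmodule (tensor M L)) D.

Definition tensor_map (x : tensor M L) : tensor M L := pre_map (repr x).

Fact pre_mapB : zmod_morphism pre_map.
Proof. exact: (lift_is_additive (M := zmodule (tensor M L))). Qed.
HB.instance Definition _ := GRing.isZmodMorphism.Build _ _ pre_map pre_mapB.

Fact pre_mapU m l : pre_map (tgen m l) = pure (f m) l.
Proof. by rewrite /pre_map liftU scale1r. Qed.

Fact tensor_map_pi D : tensor_map (\pi_(quotgrp (tensor_ker M L)) D) = pre_map D.
Proof.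
have rel : tensor_relations (addker pre_map).
  split=> *; rewrite addkerP !raddfB /= !pre_mapU.
  - by rewrite raddfD pureDl addrAC addrK subrr.
  - by rewrite pureDr addrAC addrK subrr.
  - by rewrite linearZ pureZ subrr.
rewrite /tensor_map; apply/eqP; rewrite -subr_eq0 -raddfB -addkerP.
have : repr (\pi_(quotgrp (tensor_ker M L)) D) - D \in tensor_ker M L.
  by rewrite Quotient.idealrBE reprK.
by move/asboolP; apply.
Qed.

Lemma tensor_map_pure m l : tensor_map (pure m l) = pure (f m) l.
Proof. by rewrite [LHS]tensor_map_pi pre_mapU. Qed.

Lemma tensor_mapB : zmod_morphism tensor_map.
Proof.
move=> x y; rewrite -[x]reprK -[y]reprK -raddfB !tensor_map_pi.
exact: raddfB.
Qed.
HB.instance Definition _ :=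
  GRing.isZmodMorphism.Build (tensor M L) (tensor M L) tensor_map tensor_mapB.
End TensorMap.

Section LinearGroups.
Variables (n : nat) (F : finFieldType).
Local Open Scope group_scope.

Definition SLset : {set {'GL_n[F]}} := [set A : {'GL_n[F]} | (\det A == 1)%R].

Lemma SL_group_set : group_set SLset.
Proof.
apply/group_setP; split=> [|A B]; rewrite !inE; first by rewrite GL_1E det1.
by rewrite GL_ME det_mulmx => /eqP-> /eqP->; rewrite mulr1.
Qed.
Canonical SL : {group {'GL_n[F]}} := Group SL_group_set.

Definition PSL : {group coset_of 'Z(SL)} := (SL / 'Z(SL))%G.

End LinearGroups.

(* The order of the matrices in {'GL_n[F]} is n.-1.+1, which is n for n > 0. *)
Section Modules.
Variables (n : nat) (F : finFieldType).

Definition Nat : lmodType F := 'cV[F]_n.-1.+1.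

Definition Nat_act (A : {'GL_n[F]}) : {linear Nat -> Nat} :=
  GRing.Linear.clone _ _ _ _ (mulmx (GLval A)) _.

Definition traceless : pred 'M[F]_n.-1.+1 := [pred X | \tr X == 0].

Lemma traceless_closed : submod_closed traceless.
Proof.
split=> [|a X Y]; rewrite !inE ?mxtrace0 // => /eqP tX /eqP tY.
by rewrite mxtraceD mxtraceZ tX tY mulr0 addr0.
Qed.
HB.instance Definition _ :=
  GRing.isSubmodClosed.Build F 'M[F]_n.-1.+1 traceless traceless_closed.

Definition Ad : Type := {X : 'M[F]_n.-1.+1 | X \in traceless}.
HB.instance Definition _ := SubChoice.on Ad.
HB.instance Definition _ := [SubChoice_isSubLmodule of Ad by <:].

Lemma conj_traceless (A : {'GL_n[F]}) (X : Ad) :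
  GLval A *m val X *m GLval A^-1%g \in traceless.
Proof.
rewrite inE mxtrace_mulC mulmxA -[_ *m GLval A]/(GLval (A^-1 * A)%g) mulVg.
by rewrite mul1mx; exact: (valP X).
Qed.

Definition conj_act (A : {'GL_n[F]}) (X : Ad) : Ad :=
  exist (fun Y => Y \in traceless) _ (conj_traceless A X).

Lemma conj_act_linear A : linear (conj_act A).
Proof.
by move=> a X Y; apply: val_inj; rewrite /= !linearP /= mulmxDl -scalemxAl.
Qed.
HB.instance Definition _ A :=
  GRing.isLinear.Build F Ad Ad _ (conj_act A) (conj_act_linear A).

End Modules.

Lemma SL_center_scalar (n : nat) (F : finFieldType) (Z : {'GL_n[F]}) :
  Z \in 'Z(SL n F)%g -> exists z : F, GLval Z = z%:M.
Proof.
case/centerP => _ Zc.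
have comm i j : i != j ->
    GLval Z *m delta_mx i j = delta_mx i j *m GLval Z :> 'M[F]_n.-1.+1.
  move=> neq_ij.
  pose T : 'M[F]_n.-1.+1 := 1%:M + delta_mx i j.
  have detT : \det T = 1.
    have detL (B : 'M[F]_n.-1.+1) : is_trig_mx B -> (forall k, B k k = 1) ->
        \det B = 1.
      by move=> /det_trig-> B1; rewrite big1 // => k _; rewrite B1.
    have T1 k : T k k = 1.
      rewrite !mxE eqxx; case: (k =P i) => [->|]; last by rewrite addr0.
      by rewrite (negPf neq_ij) addr0.
    case: (ltngtP i j) => [lt_ij|lt_ji|/val_inj eq_ij]; last 1 first.
    - by rewrite eq_ij eqxx in neq_ij.
    - rewrite -det_tr; apply: detL => [|k]; last by rewrite mxE T1.
      apply/is_trig_mxP => k l lt_kl; rewrite !mxE.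
      rewrite -val_eqE /= (gtn_eqF lt_kl) add0r.
      case: (l =P i) => // li; case: (k =P j) => // kj.
      by move: lt_kl; rewrite li kj ltnNge (ltnW lt_ij).
    - apply: detL => //; apply/is_trig_mxP => k l lt_kl; rewrite !mxE.
      rewrite -val_eqE /= (ltn_eqF lt_kl) add0r.
      case: (k =P i) => // ki; case: (l =P j) => // lj.
      by move: lt_kl; rewrite ki lj ltnNge (ltnW lt_ji).
  have uT : T \is a GRing.unit by rewrite unitmxE detT unitr1.
  pose gT : {'GL_n[F]} := Sub T uT.
  have gT_SL : gT \in SL n F by rewrite inE /= detT.
  have /(congr1 GLval) := Zc _ gT_SL.
  rewrite !GL_MxE /= /T mulmxDr mulmxDl mulmx1 mul1mx.
  exact: addrI.
have entry (A : 'M[F]_n.-1.+1) i j k l :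
    (A *m delta_mx i j) k l = A k i *+ (l == j)
    /\ (delta_mx i j *m A) k l = A j l *+ (k == i).
  split; rewrite mxE.
    rewrite (bigD1 i) //= big1 ?addr0 => [|m /negPf nm].
      by rewrite mxE eqxx mulr_natr.
    by rewrite mxE nm mulr0.
  rewrite (bigD1 j) //= big1 ?addr0 => [|m /negPf nm].
    by rewrite mxE eqxx andbT mulr_natl.
  by rewrite mxE nm andbF mul0r.
exists (GLval Z ord0 ord0); apply/matrixP => k i; rewrite mxE.
case: eqVneq => [<-|neq_ki].
  have [->//|neq_k0] := eqVneq k ord0.
  have := congr1 (fun B : 'M_ _ => B k ord0) (comm k ord0 neq_k0).
  by rewrite (entry _ _ _ _ _).1 (entry _ _ _ _ _).2 !eqxx.
have neq_ik : i != k by rewrite eq_sym.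
have := congr1 (fun B : 'M_ _ => B k k) (comm i k neq_ik).
by rewrite (entry _ _ _ _ _).1 (entry _ _ _ _ _).2 eqxx (negPf neq_ki).
Qed.

(* PSL acts on Ad through coset representatives; by PSL_act_coset the choice of
   the representative is immaterial. *)
Definition PSL_act (n : nat) (F : finFieldType) (c : coset_of 'Z(SL n F)) :
    {linear Ad n F -> Ad n F} :=
  GRing.Linear.clone _ _ _ _ (conj_act (fingroup.repr c)) _.

Lemma PSL_act_coset (n : nat) (F : finFieldType) (A : {'GL_n[F]}) (X : Ad n F) :
  A \in SL n F -> PSL_act (coset 'Z(SL n F) A) X = conj_act A X.
Proof.
move=> A_SL; have nA : A \in 'N('Z(SL n F))%g.
  exact: subsetP (gFnorm _ _) _ A_SL.
have : fingroup.repr (coset 'Z(SL n F) A) \in ('Z(SL n F) :* A)%g.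
  by rewrite -val_coset //; exact: mem_repr_coset.
case/rcosetP => Z /SL_center_scalar[z defZ] defR.
apply: val_inj; change (GLval (fingroup.repr (coset 'Z(SL n F) A)) *m val X *m
  GLval (fingroup.repr (coset 'Z(SL n F) A))^-1%g
  = GLval A *m val X *m GLval A^-1%g).
rewrite defR invMg !GL_MxE defZ.
have ZV : z%:M *m GLval Z^-1%g = 1%:M :> 'M[F]_n.-1.+1.
  by rewrite -defZ -GL_MxE mulgV.
have aux (R : fieldType) m (a : R) (B Y B' C : 'M[R]_m) :
    a%:M *m C = 1%:M -> a%:M *m B *m Y *m (B' *m C) = B *m Y *m B'.
  rewrite !mul_scalar_mx => aC.
  by rewrite -!scalemxAl scalemxAr scalemxAr aC mulmx1.
exact: aux ZV.
Qed.

Record vspace_on (F : fieldType) (L : zmodType) := VspaceOn {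
  vscale : F -> L -> L;
  vscaleA : forall a b x, vscale a (vscale b x) = vscale (a * b) x;
  vscale1 : left_id 1 vscale;
  vscaleDr : right_distributive vscale +%R;
  vscaleDl : forall x, {morph vscale^~ x : a b / a + b}
}.

Definition vspace (F : fieldType) (L : zmodType) (s : vspace_on F L) : Type := L.

HB.instance Definition _ (F : fieldType) (L : zmodType) (s : vspace_on F L) :=
  GRing.Zmodule.on (vspace s).
HB.instance Definition _ (F : fieldType) (L : zmodType) (s : vspace_on F L) :=
  GRing.Zmodule_isLmodule.Build F (vspace s)
    (vscaleA s) (vscale1 s) (vscaleDr s) (vscaleDl s).

Definition NatL (n : nat) (F : finFieldType) (L : lmodType F) : zmodType :=
  tensor (Nat n F) L.
Definition NatL_act (n : nat) (F : finFieldType) (L : lmodType F)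
    (A : {'GL_n[F]}) : {additive NatL n L -> NatL n L} :=
  GRing.Additive.clone _ _ (tensor_map (L := L) (Nat_act A)) _.

Definition AdL (n : nat) (F : finFieldType) (L : lmodType F) : zmodType :=
  tensor (Ad n F) L.
Definition AdL_act (n : nat) (F : finFieldType) (L : lmodType F)
    (c : coset_of 'Z(SL n F)) : {additive AdL n L -> AdL n L} :=
  GRing.Additive.clone _ _ (tensor_map (L := L) (PSL_act c)) _.

(* Main.v *)
Require Import Defs.
From HB Require Import structures.
From mathcomp Require Import all_boot all_order all_algebra.
From mathcomp Require Import all_fingroup all_solvable.
From mathcomp Require Import generic_quotient ring_quotient finfield.
From mathcomp Require Import boolp.
From mathcomp Require Import ring zify.
From mathcomp.multinomials Require Import freeg.

Set Implicit Arguments.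
Unset Strict Implicit.
Unset Printing Implicit Defensive.

(* In all three cases the group is SL(2, F) or PSL(2, F), and the dimension is
   used through ranks of compatible endomorphisms: by connectedness an
   endomorphism of rank 0 vanishes, one of full rank is onto, and a nilpotent
   endomorphism strictly decreases ranks.

   In characteristic 2 and dimension 2, an element g of order 3 is inverted by
   an involution, so g - 1 cannot have rank 1, hence 1 + g + g^2 = 0.  These
   relations alone make V a sum of natural modules: L is the fixed space of
   the unipotent elements, the torus gives its F-structure, and V = L + w L.

   In odd characteristic and dimension 3, let i^2 = -1 in F.  An element of
   order 3 permutes cyclically the involutions j = diag(i, 1/i), w_a and
   j w_a, where w_a = (0, a; -1/a, 0); so their common fixed space has rank 0,
   hence is trivial, and the +1-eigenspace H of j has dimension 1.  Nilpotency
   gives (u - 1)^3 = 0 for unipotent u, and u + u^-1 = 2 on H.  The relation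
   u w u = w u^-1 w then shows that V = H + (u - 1) H + w (u - 1) H, and the
   scalar a on H is defined by (u(a) - 1) l = (u(1) - 1) (a l).  It is
   multiplicative because diag(b, 1/b) centralises H and takes u(a) to
   u(b^2 a), and every element of F is a sum of two squares. *)

Import GRing.Theory.
Local Open Scope ring_scope.
Local Open Scope quotient_scope.

(** * Ranks in a modular universe *)

Lemma eq_zmodClosed (V : zmodType) (S T : zmodClosed V) : S =i T -> S = T.
Proof.
case: S T => [S [[oS] [aS]]] [T [[oT] [aT]]] /= eqST.
have {eqST} E : S = T by apply: funext => x; exact: eqST.
rewrite {}E in oS aS *.
by rewrite (Prop_irrelevance oS oT) (Prop_irrelevance aS aT).
Qed.

Definition to_subgrp (V : zmodType) (S : zmodClosed V) (x : V) (Sx : x \in S) :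
  subgrp S := exist _ x Sx.

Section Dim.
Variables (U : modular_universe) (dim : additive_dimension U).

Definition rk (A B : zmodType) (f : {additive A -> B}) : nat :=
  dim (subgrp (addim f)).

Lemma Ar_Ob (A B : zmodType) (f : A -> B) : Ar U f -> Ob U A /\ Ob U B.
Proof. by case/Ar_hom. Qed.

Lemma eq_Ar (A B : zmodType) (f g : A -> B) : f =1 g -> Ar U f -> Ar U g.
Proof. by move=> /funext->. Qed.

Lemma Ar_id (A : zmodType) : Ob U A -> Ar U (@idfun A).
Proof. by move=> OA; apply: eq_Ar (Ar_mulz 1 OA) => x; exact: mulr1z. Qed.

Lemma Ar_add (A B : zmodType) (f g : A -> B) : Ar U f -> Ar U g -> Ar U (f \+ g).
Proof.
move=> Af Ag; have [OA OB] := Ar_Ob Af.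
(* [diagonal 1] is the map from A to A x A: the index is one less than the exponent. *)
apply: eq_Ar (Ar_comp (Ar_comp (Ar_sum OB) (Ar_prod Af Ag)) (Ar_diag 1 OA)).
by [].
Qed.

Lemma Ar_opp (A B : zmodType) (f : A -> B) : Ar U f -> Ar U (\- f).
Proof.
move=> Af; have [OA OB] := Ar_Ob Af.
by apply: eq_Ar (Ar_comp (Ar_mulz (-1) OB) Af) => x; rewrite /= mulrN1z.
Qed.

Lemma Ar_sub (A B : zmodType) (f g : A -> B) : Ar U f -> Ar U g -> Ar U (f \- g).
Proof. by move=> Af Ag; exact: Ar_add Af (Ar_opp Ag). Qed.

Lemma rk_eq (A B C : zmodType) (f : {additive A -> B}) (g : {additive C -> B}) :
  (forall b, (exists a, f a = b) <-> exists c, g c = b) -> rk f = rk g.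
Proof.
move=> fg; rewrite /rk; congr (dim (subgrp _)); apply: eq_zmodClosed => b.
by apply/addimP/addimP => /fg.
Qed.

(** For trivial A, the kernel and the image of the identity are the same subgroup K, so dim A = 2
    dim K. As a group K is not literally A, hence the induction: if dim A > 0, then dim K < dim A,
    and the induction hypothesis gives dim K = 0. *)
Lemma dim_trivial (A : zmodType) : Ob U A -> (forall x : A, x = 0) -> dim A = 0.
Proof.
have [n] := ubnP (dim A); elim: n => // n IHn in A *.
rewrite ltnS => le_n OA A0; have AI := Ar_id OA.
have full (S : zmodClosed A) : S =i addker (@idfun A).
  by move=> x; rewrite (A0 x) !rpred0.
have := dim_additive dim AI.
rewrite (eq_zmodClosed (full (addim (@idfun A)))).
case: (posnP (dim A)) => // A_gt0 dimA.
have dK : (dim (subgrp (addker (@idfun A))) < n)%N.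
  apply: leq_trans le_n; move: A_gt0; rewrite dimA addn_gt0 orbb => K_gt0.
  by rewrite -[X in (X < _)%N]add0n ltn_add2r.
rewrite dimA (IHn _ dK (Ob_ker AI)) //.
by move=> x; apply: val_inj; rewrite (A0 (val x)) (A0 (val 0)).
Qed.

Lemma rk_inj (A B : zmodType) (f : {additive A -> B}) :
  Ar U f -> injective f -> rk f = dim A.
Proof.
move=> Af inj_f; rewrite (dim_additive dim Af) dim_trivial //; first exact: Ob_ker.
move=> x; apply: val_inj; apply: inj_f; have := valP x.
by rewrite addkerP raddf0 => /eqP.
Qed.

Lemma rk_restrict (A B C : zmodType) (f : {additive A -> B}) (g : {additive B -> C}) :
  Ar U f -> Ar U g ->
  rk f = (dim (subgrp (addker (g \o \val : subgrp (addim f) -> C))) + rk (g \o f))%N.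
Proof.
move=> Af Ag; have [OA OB] := Ar_Ob Af.
have Agi := Ar_comp Ag (Ar_incl OB (Ob_im Af)).
rewrite {1}/rk (dim_additive dim Agi); congr (_ + _)%N.
apply: rk_eq => c; split=> [[[b /= fb] <-]|[a <-]].
  by case/addimP: (fb) => a <-; exists a.
have fa : f a \in addim f by apply/addimP; exists a.
by exists (to_subgrp fa).
Qed.

Lemma rk_comp (A B C : zmodType) (f : {additive A -> B}) (g : {additive B -> C}) :
  Ar U f -> Ar U g -> (rk (g \o f) <= rk f)%N.
Proof. by move=> Af Ag; rewrite (rk_restrict Af Ag) leq_addl. Qed.

(** Rank-nullity for g on im f. The map k serves to present im f ∩ ker g directly inside B, whereas
    the kernel produced by [rk_restrict] is a subgroup of a subgroup; composing its inclusions,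
    which are injective, identifies the two dimensions. *)
Lemma rk_split (A A' B C : zmodType) (f : {additive A -> B}) (g : {additive B -> C})
    (k : {additive A' -> B}) :
  Ar U f -> Ar U g ->
  (forall b, (exists a, k a = b) <-> (exists a, f a = b) /\ g b = 0) ->
  rk f = (rk k + rk (g \o f))%N.
Proof.
move=> Af Ag kE; have [OA OB] := Ar_Ob Af; have Oi := Ob_im Af.
have Ai := Ar_incl OB Oi; have Agi := Ar_comp Ag Ai.
rewrite (rk_restrict Af Ag); congr (_ + _)%N.
have Oki := Ob_ker Agi; have Aki := Ar_incl Oi Oki; have Akii := Ar_comp Ai Aki.
rewrite -(rk_inj Akii); last by apply: inj_comp; exact: val_inj.
apply: rk_eq => b; rewrite kE; split=> [[x <-]|[[a fa] gb]].
  by split; [case/addimP: (valP (val x)) => a; exists a | apply/eqP/(valP x)].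
have fb : b \in addim f by apply/addimP; exists a.
have kb : to_subgrp fb \in addker (g \o \val : subgrp (addim f) -> C).
  exact: introT eqP gb.
by exists (to_subgrp kb).
Qed.

Lemma rk_zero (A B : zmodType) (f : {additive A -> B}) :
  Ar U f -> (forall v, f v = 0) -> rk f = 0%N.
Proof.
move=> Af f0; apply: (dim_trivial (Ob_im Af)) => x; apply: val_inj.
by case/addimP: (valP x) => a <-; rewrite f0.
Qed.

Lemma rk_conj (V : zmodType) (f g s s' : {additive V -> V}) :
  Ar U f -> Ar U s -> Ar U s' -> cancel s s' -> cancel s' s ->
  (forall v, g (s v) = s (f v)) -> rk g = rk f.
Proof.
move=> Af As As' sK s'K gs.
have -> : rk g = rk (s \o f).
  apply: rk_eq => b; split=> [[a <-]|[a <-]]; last by exists (s a); rewrite gs.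
  by exists (s' a); rewrite /= -gs s'K.
apply/eqP; rewrite eqn_leq (rk_comp Af As) /=.
apply: leq_trans (rk_comp (Ar_comp As Af) As'); rewrite leq_eqVlt; apply/orP; left.
by apply/eqP/rk_eq => b; split=> [[a <-]|[a <-]]; exists a; rewrite /= sK.
Qed.

(** * Ranks on a dim-connected module *)

Section Connected.
Variable V : zmodType.
Hypothesis connV : dim_connected dim V.

(** By additivity the kernel has the dimension of V, so connectedness forbids a vector outside
    it. *)
Lemma rk_eq0 (B : zmodType) (f : {additive V -> B}) :
  Ar U f -> rk f = 0%N -> forall v, f v = 0.
Proof.
move=> Af f0 v; apply/eqP; rewrite -addkerP; apply/contraT => nfv.
have := connV (Ob_ker Af) (ex_intro _ v nfv).
by rewrite [in ltnRHS](dim_additive dim Af) -/(rk f) f0 addn0 ltnn.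
Qed.

Lemma rk_surj (f : {additive V -> V}) :
  Ar U f -> rk f = dim V -> forall v, exists w, f w = v.
Proof.
move=> Af fV v; apply/addimP/contraT => nfv.
by have := connV (Ob_im Af) (ex_intro _ v nfv); rewrite -fV ltnn.
Qed.

(* im f inherits connectedness, so a proper submodule of it drops dimension. *)
Lemma rk_im (A B : zmodType) (f : {additive V -> B}) (g : {additive A -> B}) :
  Ar U f -> Ar U g -> (forall a, exists v, f v = g a) -> rk g = rk f ->
  forall v, exists a, g a = f v.
Proof.
move=> Af Ag gf rgf v; have [_ OB] := Ar_Ob Af.
have Api := Ar_pi OB (Ob_im Ag).
have piE b : (\pi_(quotgrp (addim g)) b == 0) = (b \in addim g).
  by rewrite -[b in RHS]subr0 Quotient.idealrBE raddf0.
have := rk_split (k := g) Af Api; rewrite rgf => /(_ _)/esym/eqP.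
rewrite -[X in _ == X]addn0 eqn_add2l => r0.
apply/addimP; rewrite -piE; apply/eqP.
apply: (rk_eq0 (Ar_comp Api Af)); apply/eqP/r0 => b; split.
  by move=> [a <-]; split; [exact: gf | apply/eqP; rewrite piE; apply/addimP; exists a].
by case=> _ /eqP; rewrite piE => /addimP.
Qed.

(** y preserves im f, and equal ranks make it map im f onto itself by [rk_im]; then so does its k-th
    power, which kills im f. *)
Lemma rk_nilpotent (f y : {additive V -> V}) k :
  Ar U f -> Ar U y -> (forall v, exists w, f w = y (f v)) ->
  (forall v, iter k y (f v) = 0) -> rk (y \o f) = rk f -> forall v, f v = 0.
Proof.
move=> Af Ay yf yk ryf v.
have onto := rk_im Af (Ar_comp Ay Af) yf ryf.
suff : exists w, iter k y (f w) = f v by case=> w; rewrite yk.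
elim: k {yk} => [|k [w <-]]; first by exists v.
by case: (onto w) => u <-; exists u; rewrite iterSr.
Qed.
End Connected.

End Dim.

(** * Tensor products *)

Definition to_additive (A B : zmodType) (f : A -> B) (fB : zmod_morphism f) :
  {additive A -> B} := HB.pack f (GRing.isZmodMorphism.Build A B f fB).

Section TensorProduct.
Variables (F : fieldType) (M L : lmodType F).

Lemma tensor_ind (P : tensor M L -> Prop) :
  (forall m l, P (pure m l)) -> (forall x y, P x -> P y -> P (x - y)) ->
  forall x, P x.
Proof.
move=> Pp PB x; have P0 : P 0 by rewrite -(subrr (pure (0 : M) (0 : L))); exact: PB.
have PN y : P y -> P (- y) by rewrite -sub0r; exact: PB.
have PD y z : P y -> P z -> P (y + z).
  by move=> Py Pz; rewrite -[z]opprK; exact: PB Py (PN _ Pz).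
rewrite -[x]reprK -[repr x]freeg_sumE raddf_sum; apply: (big_ind P) => // -[m l] _.
rewrite -[coeff _ _]intz -freegU_mulz raddfMz -/(pure m l).
have PMn n : P (pure m l *+ n) by elim: n => // n Pn; rewrite mulrS; exact: PD.
by case: (coeff _ _) => n; rewrite ?NegzE ?mulrNz; [| apply: PN]; exact: PMn.
Qed.

(** Universal property: the extension of B to the free abelian group kills the tensor relations, so
    its kernel contains [tensor_ker] and its value does not depend on the representative. *)
Lemma tensor_lift (V : zmodType) (B : M -> L -> V) :
  (forall m, {morph B m : l l' / l + l'}) -> 
  (forall m m' l, B (m + m') l = B m l + B m' l) ->
  (forall a m l, B (a *: m) l = B m (a *: l)) ->
  exists theta : {additive tensor M L -> V}, forall m l, theta (pure m l) = B m l.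
Proof.
move=> BDr BDl BZ.
pose pre (D : {freeg (M * L)%type}) : V :=
  fglift (fun p : M * L => B p.1 p.2 : zmodule V) D.
have preB : zmod_morphism pre by exact: (lift_is_additive (M := zmodule V)).
pose pre' := to_additive preB.
have preU m l : pre' (tgen m l) = B m l by rewrite /= /pre liftU scale1r.
have rel : tensor_relations (addker pre').
  split=> *; rewrite addkerP !raddfB !preU.
  - by rewrite BDl addrAC addrK subrr.
  - by rewrite BDr addrAC addrK subrr.
  - by rewrite BZ subrr.
have preE D : pre' (repr (\pi_(quotgrp (tensor_ker M L)) D)) = pre' D.
  apply/eqP; rewrite -subr_eq0 -raddfB -addkerP.
  have : repr (\pi_(quotgrp (tensor_ker M L)) D) - D \in tensor_ker M L.
    by rewrite Quotient.idealrBE reprK.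
  by move/asboolP; apply.
have thB : zmod_morphism (fun x : tensor M L => pre' (repr x)).
  by move=> x y; rewrite -[x in LHS]reprK -[y in LHS]reprK -raddfB preE raddfB.
exists (to_additive thB) => m l.
by rewrite -preU; exact: preE.
Qed.

(** V is the direct sum of the copies b_i(L), matched with e_i ⊗ L. The map theta from the tensor
    product to V comes from the universal property and psi is its inverse, so equivariance needs
    checking only on the vectors b_i(l). *)
Lemma tensor_basis_iso (V : zmodType) (I : finType) (e : I -> M)
    (coord : I -> {scalar M}) (b : I -> {additive L -> V}) :
  (forall m, m = \sum_i coord i m *: e i) ->
  (forall i k, coord i (e k) = (i == k)%:R) ->
  (forall v, exists x : I -> L, v = \sum_i b i (x i)) ->
  (forall x : I -> L, \sum_i b i (x i) = 0 -> forall i, x i = 0) ->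
  exists2 psi : {additive V -> tensor M L}, bijective psi &
    forall (g : {additive V -> V}) (f : {linear M -> M}),
      (forall i l, g (b i l) = \sum_n b n (coord n (f (e i)) *: l)) ->
      forall v, psi (g v) = tensor_map f (psi v).
Proof.
move=> eE coordE onto inj.
pose B m l := \sum_i b i (coord i m *: l).
have [m l l'|m m' l|a m l|theta thetaE] := @tensor_lift V B.
- by rewrite -big_split; apply: eq_bigr => i _; rewrite scalerDr raddfD.
- by rewrite -big_split; apply: eq_bigr => i _; rewrite raddfD scalerDl raddfD.
- by apply: eq_bigr => i _; rewrite linearZ /= scalerA mulrC.
have thb i l : theta (pure (e i) l) = b i l.
  rewrite thetaE /B (bigD1 i) //= coordE eqxx scale1r big1 ?addr0 // => k /negPf nki.
  by rewrite coordE nki scale0r raddf0.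
have form x : exists y : I -> L, x = \sum_i pure (e i) (y i).
  elim/tensor_ind: x => [m l|x x' [y ->] [y' ->]].
    exists (fun i => coord i m *: l); rewrite [in LHS](eE m).
    have pD : {morph (fun m => pure m l : tensor M L) : m1 m2 / m1 + m2}.
      by move=> m1 m2; exact: pureDl.
    have p0 : pure 0 l = 0 :> tensor M L.
      by apply: (addrI (pure 0 l)); rewrite -pureDl !addr0.
    by rewrite (big_morph _ pD p0); apply: eq_bigr => i _; rewrite pureZ.
  exists (fun i => y i - y' i); rewrite -sumrB; apply: eq_bigr => i _.
  by apply/eqP; rewrite subr_eq -pureDr subrK.
have inj_theta : injective theta.
  apply: raddf_inj => x; case: (form x) => y ->; rewrite raddf_sum => y0.
  have {}y0 : forall i, y i = 0.
    by apply: inj; rewrite -[RHS]y0; apply: eq_bigr => i _; rewrite thb.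
  have p0 i : pure (e i) 0 = 0 :> tensor M L.
    by apply: (addrI (pure (e i) 0)); rewrite -pureDr !addr0.
  by rewrite big1 // => i _; rewrite y0.
have surj v : exists x, theta x = v.
  case: (onto v) => x ->; exists (\sum_i pure (e i) (x i)).
  by rewrite raddf_sum; apply: eq_bigr => i _.
have [psi psiK] := choice surj.
have thetaK : cancel theta psi by move=> x; apply: inj_theta.
exists (to_additive (can2_zmod_morphism thetaK psiK)); first by exists theta.
move=> g f gf v; apply: inj_theta; rewrite /= psiK -{1}[v]psiK.
have [y ->] := form (psi v); rewrite !raddf_sum; apply: eq_bigr => i _.
rewrite thb gf /= tensor_map_pure thetaE; exact: eq_bigr.
Qed.
Lemma eq_tensor_map (f g : {linear M -> M}) x :
  (forall m, f m = g m) -> tensor_map (L := L) f x = tensor_map g x.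
Proof.
move=> fg; elim/tensor_ind: x => [m l|x y ex ey]; first by rewrite !tensor_map_pure fg.
have eB (e : {linear M -> M}) (z t : tensor M L) :
  tensor_map e (z - t) = tensor_map e z - tensor_map e t := raddfB (tensor_map e) z t.
by rewrite !eB ex ey.
Qed.

Lemma tensor_map_comp (f g h : {linear M -> M}) x :
  (forall m, h m = f (g m)) -> tensor_map (L := L) h x = tensor_map f (tensor_map g x).
Proof.
move=> hE; elim/tensor_ind: x => [m l|x y ex ey]; first by rewrite !tensor_map_pure hE.
have eB (e : {linear M -> M}) (z t : tensor M L) :
  tensor_map e (z - t) = tensor_map e z - tensor_map e t := raddfB (tensor_map e) z t.
by rewrite !eB ex ey.
Qed.
End TensorProduct.

(** * Linear identities in abelian groups *)

Section SquareZero.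
Variable V : zmodType.

(* The square-zero extension of int by V: it lets [ring] decide linear
   identities in the abelian group V. *)
Definition sqzero : Type := (int * V)%type.
HB.instance Definition _ := GRing.Zmodule.on sqzero.

Definition sqzero_mul (x y : sqzero) : sqzero :=
  (x.1 * y.1, x.2 *~ y.1 + y.2 *~ x.1).

Fact sqzero_mulA : associative sqzero_mul.
Proof.
move=> [a x] [b y] [c z]; congr (_, _); first exact: mulrA.
by rewrite /= !mulrzDl addrA -!mulrzA [b * c]mulrC [a * b]mulrC [c * a]mulrC.
Qed.

Fact sqzero_mulC : commutative sqzero_mul.
Proof. by move=> [a x] [b y]; rewrite /sqzero_mul /= mulrC addrC. Qed.

Fact sqzero_mul1 : left_id ((1, 0) : sqzero) sqzero_mul.
Proof. by move=> [a x]; rewrite /sqzero_mul /= mul1r mul0rz add0r. Qed.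

Fact sqzero_mulDl : left_distributive sqzero_mul +%R.
Proof.
move=> [a x] [b y] [c z]; congr (_, _); first exact: mulrDl.
by rewrite /= mulrzDl mulrzDr addrACA.
Qed.

Fact sqzero_oner_neq0 : ((1, 0) : sqzero) != 0.
Proof. by []. Qed.

HB.instance Definition _ := GRing.Zmodule_isComNzRing.Build sqzero
  sqzero_mulA sqzero_mulC sqzero_mul1 sqzero_mulDl sqzero_oner_neq0.

Definition sqzero_in (v : V) : sqzero := (0, v).

Fact sqzero_inB : zmod_morphism sqzero_in.
Proof. by move=> x y; congr (_, _). Qed.
HB.instance Definition _ := GRing.isZmodMorphism.Build V sqzero sqzero_in sqzero_inB.

Lemma sqzero_in_inj : injective sqzero_in.
Proof. by move=> x y []. Qed.
End SquareZero.

Ltac zmod := apply: sqzero_in_inj; ring.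
(** Derives a linear consequence of a = b with a multiplier n supplied by hand; the remaining
    identity in V is one that [zmod] can decide. *)
Lemma eq_lin (V : zmodType) (a b x y : V) (h : a = b) n : x - y = (a - b) *~ n -> x = y.
Proof. by rewrite h subrr mul0rz => /subr0_eq. Qed.

Lemma eq_lin2 (V : zmodType) (a b a' b' x y : V) (h : a = b) (h' : a' = b') n n' :
  x - y = (a - b) *~ n + (a' - b') *~ n' -> x = y.
Proof. by rewrite h h' !subrr !mul0rz addr0 => /subr0_eq. Qed.

(** * The group SL(2, F) *)

Ltac fld := field; repeat (apply/andP; split); rewrite ?oppr_eq0 ?oner_eq0 ?invr_eq0 //.

Lemma ord2_case (i : 'I_2) : i = 0 \/ i = 1.
Proof. by case: i => [[|[|[]]]] // ?; [left | right]; apply: val_inj. Qed.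

Section SL2.
Variable F : finFieldType.

Definition mx2 (a b c d : F) : 'M[F]_2 :=
  \matrix_(i, j) if i == 0 then if j == 0 then a else b
                 else if j == 0 then c else d.

Lemma mx2_eta (A : 'M[F]_2) : A = mx2 (A 0 0) (A 0 1) (A 1 0) (A 1 1).
Proof.
apply/matrixP => i j; rewrite mxE.
by case: (ord2_case i) => ->; case: (ord2_case j) => ->.
Qed.

Lemma mx2M a b c d a' b' c' d' : mx2 a b c d *m mx2 a' b' c' d' =
  mx2 (a * a' + b * c') (a * b' + b * d') (c * a' + d * c') (c * b' + d * d').
Proof.
apply/matrixP => i j; rewrite !mxE big_ord_recl big_ord1 !mxE /=.
by case: ifP; case: ifP.
Qed.

Lemma mx2_1 : mx2 1 0 0 1 = 1%:M.
Proof. by rewrite [RHS]mx2_eta !mxE. Qed.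

Lemma det_mx2 a b c d : \det (mx2 a b c d) = a * d - b * c.
Proof.
rewrite (expand_det_row _ 0) big_ord_recl big_ord1 /cofactor !det_mx11 !mxE /=.
by rewrite expr0 expr1 mul1r mulN1r mulrN.
Qed.

(* The junk value is 1 when the determinant vanishes. *)
Definition sl2 (a b c d : F) : {'GL_2[F]} := insubd (1%g : {'GL_2[F]}) (mx2 a b c d).

Lemma GLval_inj : injective (@GLval 2 F).
Proof. exact: val_inj. Qed.

Lemma val_sl2 a b c d : a * d - b * c = 1 -> GLval (sl2 a b c d) = mx2 a b c d.
Proof.
by move=> det1; apply: insubdK; rewrite unfold_in /= unitmxE det_mx2 det1 unitr1.
Qed.

Lemma sl2_SL a b c d : a * d - b * c = 1 -> sl2 a b c d \in SL 2 F.
Proof. by move=> det1; rewrite inE val_sl2 // det_mx2 det1. Qed.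

Lemma sl2_1 : sl2 1 0 0 1 = 1%g.
Proof. by apply: GLval_inj; rewrite val_sl2 ?mx2_1 // mulr0 mulr1 subr0. Qed.

Lemma sl2M a b c d a' b' c' d' : a * d - b * c = 1 -> a' * d' - b' * c' = 1 ->
  (sl2 a b c d * sl2 a' b' c' d')%g =
  sl2 (a * a' + b * c') (a * b' + b * d') (c * a' + d * c') (c * b' + d * d').
Proof.
move=> det1 det1'; apply: GLval_inj; rewrite GL_MxE !val_sl2 ?mx2M //.
by rewrite -det_mx2 -mx2M det_mulmx !det_mx2 det1 det1' mulr1.
Qed.

Lemma sl2V a b c d : a * d - b * c = 1 -> (sl2 a b c d)^-1%g = sl2 d (- b) (- c) a.
Proof.
move=> det1; apply: (mulgI (sl2 a b c d)); rewrite mulgV sl2M //; last first.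
  by rewrite -det1; ring.
by rewrite -sl2_1; congr (sl2 _ _ _ _); rewrite -?det1; ring.
Qed.

Lemma SL_sl2 (A : {'GL_2[F]}) : A \in SL 2 F ->
  exists a b c d, a * d - b * c = 1 /\ A = sl2 a b c d.
Proof.
rewrite inE => /eqP detA; pose M : 'M[F]_2 := GLval A.
have det1 : M 0 0 * M 1 1 - M 0 1 * M 1 0 = 1 by rewrite -det_mx2 -mx2_eta.
exists (M 0 0), (M 0 1), (M 1 0), (M 1 1); split=> //.
by apply: GLval_inj; rewrite val_sl2 // -mx2_eta.
Qed.

(** Bruhat decomposition: the matrix is u(a/c) w_(-1/c) u(d/c) when c != 0, and u(ab) diag(a, 1/a)
    with diag(a, 1/a) = w_a w_(-1) when c = 0. *)
Lemma SL2_ind (P : {'GL_2[F]} -> Prop) :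
  (forall a, P (sl2 1 a 0 1)) -> (forall a, a != 0 -> P (sl2 0 a (- a^-1) 0)) ->
  {in SL 2 F &, forall A B, P A -> P B -> P (A * B)%g} ->
  {in SL 2 F, forall A, P A}.
Proof.
move=> PU PW PM A /SL_sl2[a [b [c [d [det1 ->]]]]].
have detU x : 1 * 1 - x * 0 = 1 :> F by rewrite mulr0 mulr1 subr0.
have detW x : x != 0 -> 0 * 0 - x * (- x^-1) = 1 :> F by move=> x0; field.
have [c0|c0] := eqVneq c 0.
  have a0 : a != 0.
    by apply: contra_eq_neq det1 => ->; rewrite c0 mul0r mulr0 subrr eq_sym oner_eq0.
  have -> : sl2 a b c d =
      mulg (sl2 1 (a * b) 0 1) (mulg (sl2 0 a (- a^-1) 0) (sl2 0 (-1) (- (-1)^-1) 0)).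
    have N1 : (-1 : F) != 0 by rewrite oppr_eq0 oner_eq0.
    have dE : d = a^-1 by apply: (mulfI a0); rewrite mulfV // -det1 c0 mulr0 subr0.
    rewrite !sl2M ?detU ?detW //; last by rewrite invrN1; field.
    by rewrite c0 dE invrN1; congr (sl2 _ _ _ _); field.
  have N1 : (-1 : F) != 0 by rewrite oppr_eq0 oner_eq0.
  by apply: (PM); [exact/sl2_SL/detU | apply: groupM; exact/sl2_SL/detW | | apply: (PM);
     [exact/sl2_SL/detW | exact/sl2_SL/detW | exact: PW | exact: PW]].
have c'0 : - c^-1 != 0 by rewrite oppr_eq0 invr_eq0.
have -> : sl2 a b c d = 
    mulg (sl2 1 (a / c) 0 1)
      (mulg (sl2 0 (- c^-1) (- (- c^-1)^-1) 0) (sl2 1 (d / c) 0 1)).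
  rewrite !sl2M ?detU ?detW //; last by field; rewrite c0 oppr_eq0 oner_eq0.
  have bE : b = (a * d - 1) / c by rewrite -det1; field.
  by rewrite bE; congr (sl2 _ _ _ _); field; rewrite ?c0 ?oppr_eq0 ?oner_eq0.
by apply: (PM); [exact/sl2_SL/detU
  | apply: groupM; [exact/sl2_SL/detW | exact/sl2_SL/detU] | | apply: (PM);
     [exact/sl2_SL/detW | exact/sl2_SL/detU | exact: PW | exact: PU]].
Qed.
End SL2.

(** * A basis of Ad(2, F) *)

Lemma conj_actM (n : nat) (F : finFieldType) (A B : {'GL_n[F]}) (X : Ad n F) :
  conj_act (mulg A B) X = conj_act A (conj_act B X).
Proof.
apply: val_inj; change (GLval (mulg A B) *m val X *m GLval (mulg A B)^-1%g =
  GLval A *m (GLval B *m val X *m GLval B^-1%g) *m GLval A^-1%g).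
by rewrite invMg !GL_MxE !mulmxA.
Qed.

Section AdBasis.
Variable F : finFieldType.

Fact mx2_traceless (a b c : F) : mx2 a b c (- a) \in traceless (n := 2) (F := F).
Proof.
apply/eqP; rewrite /mxtrace [LHS]big_ord_recl big_ord1 !mxE /=.
by rewrite subrr.
Qed.

Definition ad2 (a b c : F) : Ad 2 F := exist _ (mx2 a b c (- a)) (mx2_traceless a b c).

Lemma ad2_eta (X : Ad 2 F) : X = ad2 (val X 0 0) (val X 0 1) (val X 1 0).
Proof.
apply: val_inj; rewrite [LHS](mx2_eta (val X)); congr (mx2 _ _ _ _).
have /eqP := valP X; rewrite /mxtrace [LHS]big_ord_recl big_ord1 => /eqP.
by rewrite addrC addr_eq0 => /eqP <-; congr (val X _ _); apply: val_inj.
Qed.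

Lemma conj_ad2 (a b c d x y z : F) : a * d - b * c = 1 ->
  conj_act (sl2 a b c d) (ad2 x y z) =
  ad2 ((a * x + b * z) * d - (a * y - b * x) * c)
      ((a * y - b * x) * a - (a * x + b * z) * b)
      ((c * x + d * z) * d - (c * y - d * x) * c).
Proof.
move=> det1; apply: val_inj.
have vE : val (conj_act (sl2 a b c d) (ad2 x y z)) =
    GLval (sl2 a b c d) *m mx2 x y z (- x) *m GLval (sl2 a b c d)^-1%g by [].
rewrite vE sl2V // !val_sl2 //; last by rewrite -det1; ring.
by rewrite !mx2M; congr (mx2 _ _ _ _); ring.
Qed.

(* (H, -2 E, 2 F) for the standard sl2-triple: -2 E = (u - 1) H for the
   unipotent u = 1 + E, and 2 F is the image of -2 E under the Weyl element. *)
Definition ad_basis (i : 'I_3) : Ad 2 F :=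
  if i == 0 then ad2 1 0 0 else if i == 1 then ad2 0 (- 2) 0 else ad2 0 0 2.

Definition ad_coord_fun (i : 'I_3) (X : Ad 2 F) : F :=
  if i == 0 then val X 0 0 else if i == 1 then - (val X 0 1 / 2) else val X 1 0 / 2.

Fact ad_coord_scalar i : scalar (ad_coord_fun i).
Proof.
move=> a X Y; rewrite /ad_coord_fun /= !mxE; case: ifP => // _; case: ifP => _.
  by rewrite mulrDl opprD -mulrA mulrN.
by rewrite mulrDl -mulrA.
Qed.
HB.instance Definition _ i :=
  GRing.isLinear.Build F (Ad 2 F) F _ (ad_coord_fun i) (ad_coord_scalar i).

Definition ad_coord (i : 'I_3) : {scalar (Ad 2 F)} := ad_coord_fun i.

Lemma ad_coordE i x y z : ad_coord i (ad2 x y z) =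
  if i == 0 then x else if i == 1 then - (y / 2) else z / 2.
Proof. by rewrite /ad_coord /= /ad_coord_fun /= !mxE. Qed.

Hypothesis nz2 : (2 : F) != 0.

Lemma ad_basis_coord i k : ad_coord i (ad_basis k) = (i == k)%:R.
Proof.
by case: i k => [[|[|[|//]]] ?] [[|[|[|//]]] ?];
  rewrite /ad_basis /= ad_coordE /= ?mul0r ?oppr0 ?mulNr ?opprK ?divff.
Qed.

Lemma ad_basis_sum X : X = \sum_i ad_coord i X *: ad_basis i.
Proof.
rewrite !big_ord_recl big_ord0 addr0 [X in LHS]ad2_eta; apply: val_inj.
apply/matrixP => p q; rewrite /= !mxE.
by case: (ord2_case p) => ->; case: (ord2_case q) => ->; rewrite /= /ad_coord_fun /=; fld.
Qed.
End AdBasis.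

(** * Actions of SL(2, F) *)

Section SL2Action.
Variables (F : finFieldType) (V : zmodType) (R : {'GL_2[F]} -> {additive V -> V}).
Hypothesis actR : Defs.is_action (SL 2 F) R.

Lemma act_sl2M (a b c d a' b' c' d' : F) v : a * d - b * c = 1 -> a' * d' - b' * c' = 1 ->
  R (sl2 a b c d) (R (sl2 a' b' c' d') v) =
  R (sl2 (a * a' + b * c') (a * b' + b * d') (c * a' + d * c') (c * b' + d * d')) v.
Proof.
by move=> det1 det1'; rewrite -sl2M // (proj2 actR) //; exact: sl2_SL.
Qed.

Lemma eq_sl2 (a b c d a' b' c' d' : F) v : a = a' -> b = b' -> c = c' -> d = d' ->
  R (sl2 a b c d) v = R (sl2 a' b' c' d') v.
Proof. by do 4!move=> ->. Qed.

Definition uu (a : F) := R (sl2 1 a 0 1).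
Definition ww (a : F) := R (sl2 0 a (- a^-1) 0).
Definition hh (a : F) := R (sl2 a 0 0 a^-1).

Lemma uu0 v : uu 0 v = v.
Proof. by rewrite -[RHS](proj1 actR) -sl2_1. Qed.

Lemma hh1 v : hh 1 v = v.
Proof. by rewrite -[RHS](proj1 actR) -sl2_1; apply: eq_sl2 => //; fld. Qed.

Lemma uuD (a b : F) v : uu a (uu b v) = uu (a + b) v.
Proof. by rewrite act_sl2M; [apply: eq_sl2; ring | ring | ring]. Qed.

Lemma uuNK (a : F) v : uu (- a) (uu a v) = v.
Proof. by rewrite uuD addNr uu0. Qed.

Lemma uuKN (a : F) v : uu a (uu (- a) v) = v.
Proof. by rewrite uuD subrr uu0. Qed.

Lemma hhM (a b : F) v : a != 0 -> b != 0 -> hh a (hh b v) = hh (a * b) v.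
Proof.
by move=> a0 b0; rewrite act_sl2M; [apply: eq_sl2; fld | fld | fld].
Qed.

Lemma hh_uu (b a : F) v : b != 0 -> hh b (uu a v) = uu (b ^+ 2 * a) (hh b v).
Proof.
move=> b0; rewrite act_sl2M; [|fld|fld]; rewrite act_sl2M; [|fld|fld].
by apply: eq_sl2; fld.
Qed.

Lemma wwE (a : F) v : a != 0 -> ww a v = hh a (ww 1 v).
Proof.
by move=> a0; rewrite act_sl2M; [apply: eq_sl2; fld | fld | fld].
Qed.

Lemma wwE' (a : F) v : a != 0 -> ww a v = ww 1 (hh a^-1 v).
Proof.
by move=> a0; rewrite act_sl2M; [apply: eq_sl2; fld | fld | fld].
Qed.

(** Both products equal minus the lower unipotent matrix with entry 1/a. *)
Lemma uu_ww_uu (a : F) v : a != 0 -> uu a (ww a (uu a v)) = ww a (uu (- a) (ww a v)).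
Proof.
move=> a0; do 4![rewrite act_sl2M; [|fld|fld]].
by apply: eq_sl2; fld.
Qed.

Lemma iter_uu (a : F) n v : iter n (uu a) v = uu (a *+ n) v.
Proof.
elim: n => [|n IHn]; first by rewrite mulr0n uu0.
by rewrite iterS IHn uuD mulrS.
Qed.

Hypothesis actN1 : forall v, R (sl2 (-1) 0 0 (-1)) v = v.

Lemma act_sl2N (a b c d : F) v : a * d - b * c = 1 ->
  R (sl2 (- a) (- b) (- c) (- d)) v = R (sl2 a b c d) v.
Proof.
move=> det1; rewrite -[RHS]actN1 act_sl2M //; last by ring.
by apply: eq_sl2; ring.
Qed.

Lemma wwK (a : F) v : a != 0 -> ww a (ww a v) = v.
Proof.
move=> a0; rewrite act_sl2M; [|fld|fld]; rewrite -[RHS]actN1.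
by apply: eq_sl2; fld.
Qed.

Lemma hhE (a : F) v : a != 0 -> hh a v = ww a (ww 1 v).
Proof. by move=> a0; rewrite wwE // wwK ?oner_eq0. Qed.

(** Up to sign w_1 u(1/a) w_1 is the lower unipotent with entry -1/a, and upper-lower-upper gives
    w_a. Hence a vector fixed by w_1 and all u(a) is fixed by every w_a. *)
Lemma ww_uu (a : F) v : a != 0 -> ww a v = uu a (ww 1 (uu a^-1 (ww 1 (uu a v)))).
Proof.
move=> a0; do 4![rewrite act_sl2M; [|fld|fld]].
by rewrite -act_sl2N; [apply: eq_sl2; fld | fld].
Qed.

End SL2Action.

Section Compatible.
Variables (U : modular_universe) (F : finFieldType) (V : zmodType).
Variable R : {'GL_2[F]} -> {additive V -> V}.
Hypothesis ArR : {in SL 2 F, forall A, Ar U (R A)}.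

Lemma Ar_sl2 (a b c d : F) : a * d - b * c = 1 -> Ar U (R (sl2 a b c d)).
Proof. by move=> det1; exact/ArR/sl2_SL. Qed.

Lemma Ar_uu a : Ar U (uu R a). Proof. by apply: Ar_sl2; ring. Qed.

Lemma Ar_ww (a : F) : a != 0 -> Ar U (ww R a).
Proof. by move=> a0; apply: Ar_sl2; fld. Qed.

Lemma Ar_hh (a : F) : a != 0 -> Ar U (hh R a).
Proof. by move=> a0; apply: Ar_sl2; fld. Qed.
End Compatible.

(** * Recognition of Ad(2, L) in odd characteristic *)

Section OddAction.
Variables (F : finFieldType) (V : zmodType) (R : {'GL_2[F]} -> {additive V -> V}).
Hypothesis actR : Defs.is_action (SL 2 F) R.
Hypothesis actN1 : forall v, R (sl2 (-1) 0 0 (-1)) v = v.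
Variable i : F.
Hypothesis i2 : i ^+ 2 = -1.
Hypothesis nz2 : (2 : F) != 0.
Hypothesis two_inj : forall v : V, v *+ 2 = 0 -> v = 0.
Variable k : nat.
Hypothesis quarter : forall v : V, v *+ 4 *+ k = v.

Local Notation u := (uu R).
Local Notation w := (ww R).
Local Notation h := (hh R).
Local Notation j := (hh R i).

(** These three relations are all that the recognition takes from dimension 3; they are established
    by rank arguments in [klein_rank], [cubic_rank] and [quadratic_rank]. *)
Hypothesis klein : forall (a : F) v, a != 0 -> v + j v + w a v + j (w a v) = 0.
Hypothesis cubic : forall (a : F) v,
  u a (u a (u a v)) - u a (u a v) *+ 3 + u a v *+ 3 - v = 0.
Hypothesis quadratic_H : forall (a : F) l, j l = l -> u a l + u (- a) l = l *+ 2.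

Lemma sqrtN1_neq0 : i != 0.
Proof. by apply: contra_eq_neq i2 => ->; rewrite expr0n eq_sym oppr_eq0 oner_eq0. Qed.

Let nz1 : (1 : F) != 0 := oner_neq0 F.
Hint Resolve sqrtN1_neq0 nz1 : core.

Lemma sqrtN1_uu (a : F) v : j (u a v) = u (- a) (j v).
Proof. by rewrite hh_uu // i2 mulN1r. Qed.

Lemma sqrtN1_hhK v : j (j v) = v.
Proof.
rewrite hhM // -expr2 i2 -[RHS](actN1 v).
by apply: eq_sl2 => //; rewrite invrN1.
Qed.

Lemma sqrtN1_ww (a : F) v : a != 0 -> j (w a v) = w a (j v).
Proof.
move=> a0; rewrite act_sl2M //; [|fld|fld].
rewrite act_sl2M //; [|fld|fld].
have iV : i^-1 = - i.
  by apply: (mulfI sqrtN1_neq0); rewrite mulfV // mulrN -expr2 i2 opprK.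
by rewrite -act_sl2N //; [apply: eq_sl2; rewrite ?iV; fld | fld].
Qed.

(** On H the Klein relation reads 2 (l + w_a l) = 0. *)
Lemma ww_H (a : F) l : a != 0 -> j l = l -> w a l = - l.
Proof.
move=> a0 jl; have := klein l a0; rewrite sqrtN1_ww // jl => e.
by apply/eqP; rewrite -subr_eq0; apply/eqP/two_inj; apply: (eq_lin e (n := 1)); zmod.
Qed.

Lemma hh_H (a : F) l : a != 0 -> j l = l -> h a l = l.
Proof.
by move=> a0 jl; rewrite hhE // (ww_H nz1 jl) raddfN (ww_H a0 jl) opprK.
Qed.

(** * The maps u(a) - 1 on the +1-eigenspace H of j *)

Local Notation al a l := (u a l - l).

(** Since j inverts u(a), j sends u(a) l - l to u(-a) l - l, and the quadratic relation identifies
    this with the opposite. *)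
Lemma al_E (a : F) l : j l = l -> j (al a l) = - al a l.
Proof.
move=> jl; rewrite raddfB sqrtN1_uu jl.
by apply: (eq_lin (quadratic_H a jl) (n := 1)); zmod.
Qed.

Lemma uu_half (a : F) v : (forall b, u b v = u (- b) v) -> u a v = v.
Proof.
move=> sym; have -> : a = a / 2 + a / 2 by fld.
by rewrite -uuD // sym uuKN.
Qed.

(** For x = al a l, the vector u(c) x = al (c + a) l - al c l is negated by j, as is x. Comparing
    with j u(c) = u(-c) j gives u(c) x = u(-c) x for all c, and [uu_half] applies. *)
Lemma uu_al (b a : F) l : j l = l -> u b (al a l) = al a l.
Proof.
move=> jl; apply: uu_half => c.
have jx := al_E a jl.
have ux : u c (al a l) = al (c + a) l - al c l.
  by rewrite raddfB uuD // opprB addrA subrK.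
have jux : j (u c (al a l)) = - u c (al a l).
  by rewrite ux raddfB !al_E //; zmod.
by move: jux; rewrite sqrtN1_uu jx raddfN => /oppr_inj.
Qed.

Lemma alD (a b : F) l : j l = l -> al (a + b) l = al a l + al b l.
Proof.
move=> jl; have := uu_al b a jl; rewrite raddfB uuD // addrC [b + a]addrC => e.
by apply: (eq_lin e (n := 1)); zmod.
Qed.

(** This is u w u = w u^-1 w applied to l, expanded with w l = -l and u l = l + al a l. *)
Lemma uu_w_al (a : F) l : a != 0 -> j l = l ->
  u a (w a (al a l)) = w a (al a l) + l *+ 2 + al a l.
Proof.
move=> a0 jl; have := uu_ww_uu actR l a0; have := quadratic_H a jl.
have : u a l = l + al a l by rewrite addrC subrK.
move: (al a l) (ww_H a0 jl) => B wl uB; rewrite uB wl => e.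
have -> : u (- a) (- l) = B - l.
  by rewrite raddfN; apply: (eq_lin e (n := -1)); zmod.
rewrite raddfD /= wl raddfD /= raddfN uB raddfB wl => e'.
by apply: (eq_lin e' (n := 1)); zmod.
Qed.

Lemma E_w_al (a b : F) l : b != 0 -> j l = l -> j (w b (al a l)) = - w b (al a l).
Proof. by move=> b0 jl; rewrite sqrtN1_ww // al_E // raddfN. Qed.

(** Sum of the previous relation and its image under j. It recovers l from al a l, hence yields both
    the injectivity of al and the formula for its inverse. *)
Lemma uuB_w_al (a : F) l : a != 0 -> j l = l ->
  u a (w a (al a l)) - u (- a) (w a (al a l)) = l *+ 4.
Proof.
move=> a0 jl; have := uu_w_al a0 jl; have jA := E_w_al a a0 jl; have jB := al_E a jl.
move: (al a l) (w a (al a l)) jA jB => B A jA jB e.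
have := congr1 j e; rewrite sqrtN1_uu jA raddfD /= raddfD jA jB raddfMn jl raddfN => e'.
by apply: (eq_lin2 e e' (n := 1) (n' := 1)); zmod.
Qed.

Lemma four_inj (v : V) : v *+ 4 = 0 -> v = 0.
Proof. by rewrite (mulrnA v 2 2) => /two_inj/two_inj. Qed.

Lemma al_inj (a : F) l : a != 0 -> j l = l -> al a l = 0 -> l = 0.
Proof.
move=> a0 jl e; apply: four_inj.
by rewrite -(uuB_w_al a0 jl) e !raddf0 addr0.
Qed.

Lemma uuB_H (a : F) y : j y = - y -> j (u a y - u (- a) y) = u a y - u (- a) y.
Proof. by move=> jy; rewrite raddfB !sqrtN1_uu opprK jy !raddfN opprK addrC. Qed.

(** The vector u(b) y - u(-b) y lies in H and is fixed by u(1), so it vanishes by [al_inj]; conclude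
    by [uu_half]. *)
Lemma E_fix (a : F) y : j y = - y -> u 1 y = y -> u a y = y.
Proof.
move=> jy u1; apply: uu_half => b; apply/eqP; rewrite -subr_eq0; apply/eqP.
apply: (al_inj nz1 (uuB_H b jy)); apply/eqP; rewrite subr_eq0 raddfB !uuD //.
by rewrite [1 + b]addrC [1 - b]addrC -!(uuD actR) u1.
Qed.

(** Such a y is fixed by every w_a, hence by j = w_i w_1, which also negates it. *)
Lemma E_fix_eq0 y : (forall a, u a y = y) -> w 1 y = y -> j y = - y -> y = 0.
Proof.
move=> uy wy jy; have w_fix a : a != 0 -> w a y = y.
  by move=> a0; rewrite ww_uu // !uy wy uy wy uy.
apply: two_inj; have : j y = y by rewrite hhE // wy w_fix.
by rewrite jy mulr2n => {1}<-; rewrite addNr.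
Qed.

(* With d = w y and z = u d - u^-1 d, the vector 4 y - al 1 z is fixed by w and
   by every u a, so it vanishes. *)
Lemma E_fix_al y : j y = - y -> u 1 y = y ->
  y = al 1 ((u 1 (w 1 y) - u (-1) (w 1 y)) *+ k).
Proof.
move=> jy u1; set d := w 1 y; set z := u 1 d - u (-1) d.
have jd : j d = - d by rewrite sqrtN1_ww // jy raddfN.
have jz : j z = z by exact: uuB_H.
have uU : u 1 (u (-1) d) = d by rewrite uuKN.
have e1 : al 1 z = (u 1 d + u (-1) d) *+ 2 - d *+ 4.
  have := cubic 1 (u (-1) d); rewrite uU => e.
  rewrite /z raddfB uU.
  by apply: (eq_lin e (n := 1)); zmod.
(* As u fixes y, the relation u w u y = w u^-1 w y says that w exchanges u d and u^-1 d. *)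
have wS : w 1 (u 1 d + u (-1) d) = u 1 d + u (-1) d.
  have e2 : u 1 d = w 1 (u (-1) d).
    by have := uu_ww_uu actR y nz1; rewrite u1 -/d.
  have wwd : w 1 (u 1 d) = u (-1) d by rewrite e2 wwK.
  by rewrite raddfD wwd -e2 addrC.
have wd : w 1 d = y by rewrite /d wwK.
have e3 : w 1 (y *+ 4 - al 1 z) = y *+ 4 - al 1 z.
  rewrite e1 raddfB raddfMn -/d raddfB !raddfMn wS wd.
  by rewrite /=; zmod.
have e4 : y *+ 4 = al 1 z.
  have uB a := uu_al a 1 jz; have jB := al_E 1 jz.
  move: (al 1 z) e3 uB jB => B e3 uB jB; apply: subr0_eq.
  apply: E_fix_eq0 e3 _ => [a|].
    by rewrite raddfB [u a (_ *+ _)]raddfMn uB E_fix.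
  by rewrite raddfB [j (_ *+ _)]raddfMn jy jB; zmod.
by rewrite -[LHS]quarter e4 mulrnBl [u 1 (_ *+ _)]raddfMn.
Qed.

Lemma H_mulrn v : j v = v -> j (v *+ k) = v *+ k.
Proof. by move=> jv; rewrite raddfMn jv. Qed.

Lemma H_decomp v : exists l q r, [/\ j l = l, j q = q, j r = r &
  v = l + al 1 q + w 1 (al 1 r)].
Proof.
(* Multiplication by k is division by 4, so [*+ k *+ 2] halves; l and y are the components of v in
   the two eigenspaces of j. *)
have half2 : (forall x : V, x *+ 2 *+ k *+ 2 = x).
  by move=> x; rewrite -[RHS]quarter mulrnAC -(mulrnA x 2 2).
pose l := (v + j v) *+ k *+ 2; pose y := (v - j v) *+ k *+ 2.
have jl : j l = l by rewrite !raddfMn raddfD sqrtN1_hhK addrC.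
have jy : j y = - y by rewrite /y !raddfMn raddfB sqrtN1_hhK /= opprB.
have vE : v = l + y.
  by rewrite -[LHS]half2 /l /y -!mulrnDl; congr (_ *+ _ *+ _); zmod.
(* By [uuB_w_al], u - u^-1 takes w (al 1 r) to 4 r. This r is thus the one for which u and u^-1
   agree on y1. *)
pose r := (u 1 y - u (-1) y) *+ k.
have jr : j r = r by apply/H_mulrn/uuB_H.
pose y1 := y - w 1 (al 1 r).
have jy1 : j y1 = - y1 by rewrite raddfB jy E_w_al // opprB opprK addrC.
have u1 : u 1 y1 = y1.
  have e : u 1 y1 = u (-1) y1.
    have := uuB_w_al nz1 jr; rewrite (_ : r *+ 4 = u 1 y - u (-1) y); last first.
      by rewrite /r mulrnAC quarter.
    rewrite /y1 [u 1 (_ - _)]raddfB [u (-1) (_ - _)]raddfB => e.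
    by apply: (eq_lin e (n := -1)); zmod.
  (* With u y1 = u^-1 y1, also u^2 y1 = y1, and the cubic relation collapses to 4 (y1 - u y1) =
     0. *)
  have := cubic 1 (u (-1) y1); rewrite uuKN //.
  have -> : u 1 y1 = u (-1) y1 by [].
  rewrite uuKN // -e => e'.
  apply: subr0_eq; apply: four_inj.
  by apply: (eq_lin e' (n := -1)); zmod.
exists l, ((u 1 (w 1 y1) - u (-1) (w 1 y1)) *+ k), r; split=> //.
  by apply/H_mulrn/uuB_H; rewrite sqrtN1_ww // jy1 raddfN.
rewrite -addrA -(E_fix_al jy1 u1) /y1 subrK; exact: vE.
Qed.

(** Applying j isolates l. Then u - u^-1 kills al 1 q and sends w (al 1 r) to 4 r, which isolates
    r. *)
Lemma H_indep l q r : j l = l -> j q = q -> j r = r ->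
  l + al 1 q + w 1 (al 1 r) = 0 -> [/\ l = 0, q = 0 & r = 0].
Proof.
move=> jl jq jr e; have jA := al_E 1 jq; have jB := E_w_al 1 nz1 jr.
have l0 : l = 0.
  apply: two_inj; have := congr1 j e; rewrite raddfD /= raddfD /= jA jB jl raddf0 => e'.
  by apply: (eq_lin2 e e' (n := 1) (n' := 1)); zmod.
have r0 : r = 0.
  apply: four_inj; rewrite -(uuB_w_al nz1 jr).
  have -> : w 1 (al 1 r) = - al 1 q.
    by move: e; rewrite l0 add0r => /eqP; rewrite addrC addr_eq0 => /eqP.
  by rewrite [u 1 _]raddfN [u (-1) _]raddfN !uu_al // subrr.
split=> //; apply: (al_inj nz1 jq).
by move: e; rewrite l0 r0 add0r !raddf0 addr0 raddf0 addr0.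
Qed.

(** The witness of [E_fix_al] for y = al a l: for l in H, this is the inverse of al 1 applied to al
    a l. *)
Definition scal (a : F) (l : V) : V :=
  (u 1 (w 1 (al a l)) - u (-1) (w 1 (al a l))) *+ k.

Local Notation s := scal.

Lemma scal_H (a : F) l : j l = l -> j (s a l) = s a l.
Proof. by move=> jl; apply/H_mulrn/uuB_H/E_w_al. Qed.

Lemma al_scal (a : F) l : j l = l -> al a l = al 1 (s a l).
Proof. by move=> jl; apply: E_fix_al; [exact: al_E | exact: uu_al]. Qed.

Lemma scalDr (a : F) l m : s a (l + m) = s a l + s a m.
Proof.
rewrite /scal -mulrnDl; congr (_ *+ _).
have -> : al a (l + m) = al a l + al a m by rewrite raddfD /=; zmod.
by rewrite raddfD /= raddfD /= raddfD /=; zmod.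
Qed.

Lemma scalDl (a b : F) l : j l = l -> s (a + b) l = s a l + s b l.
Proof.
move=> jl; rewrite /scal alD // -mulrnDl; congr (_ *+ _).
by rewrite raddfD /= raddfD /= raddfD /=; zmod.
Qed.

Lemma scal1 l : j l = l -> s 1 l = l.
Proof. by move=> jl; rewrite /scal uuB_w_al // quarter. Qed.

Lemma al1_inj l m : j l = l -> j m = m -> al 1 l = al 1 m -> l = m.
Proof.
move=> jl jm e; apply: subr0_eq; apply: (al_inj nz1); first by rewrite raddfB jl jm.
by rewrite raddfB /=; apply: (eq_lin e (n := 1)); zmod.
Qed.

Lemma hh_al (b a : F) l : b != 0 -> j l = l -> h b (al a l) = al (b ^+ 2 * a) l.
Proof. by move=> b0 jl; rewrite raddfB hh_uu // hh_H. Qed.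

Lemma scal_sqr (b a : F) l : b != 0 -> j l = l ->
  s (b ^+ 2 * a) l = s (b ^+ 2) (s a l).
Proof.
move=> b0 jl; have ja := scal_H a jl.
apply: al1_inj; [exact: scal_H | exact/scal_H | rewrite -!al_scal //].
by rewrite -hh_al // [al a l]al_scal // hh_al // mulr1.
Qed.

(* c = ((c + 1) / 2)^2 + (i (c - 1) / 2)^2 *)
Lemma scalA (c a : F) l : j l = l -> s c (s a l) = s (c * a) l.
Proof.
move=> jl; have sq b : s (b ^+ 2) (s a l) = s (b ^+ 2 * a) l.
  have [->|b0] := eqVneq b 0; last by rewrite scal_sqr.
  by rewrite expr0n mul0r /scal !uu0 // !subrr.
have -> : c = ((c + 1) / 2) ^+ 2 + (i * (c - 1) / 2) ^+ 2.
  by rewrite !expr_div_n exprMn i2; field; rewrite (natrM _ 2 2) mulf_neq0.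
by rewrite scalDl ?scal_H // !sq -scalDl // -mulrDl.
Qed.

Lemma uu_basis (a : F) l : j l = l -> [/\ u a l = l + al 1 (s a l),
  u a (al 1 l) = al 1 l &
  u a (w 1 (al 1 l)) = w 1 (al 1 l) + s a l *+ 2 + al 1 (s (a ^+ 2) l)].
Proof.
move=> jl; rewrite -!al_scal //; split; [by rewrite addrC subrK | exact: uu_al |].
have [->|a0] := eqVneq a 0.
  by rewrite expr0n /scal !uu0 // !subrr !(raddf0, addr0, mul0rn).
have js := scal_H a jl.
(* The vector a l is chosen so that w_a (al a (a l)) = w_1 (al 1 l): indeed w_a = w_1 diag(1/a, a),
   and the torus turns al a into al (1/a). Then [uu_w_al] at a l is the claim. *)
have wE : w a (al a (s a l)) = w 1 (al 1 l).
  rewrite wwE' // hh_al ?invr_eq0 //.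
  have -> : a^-1 ^+ 2 * a = a^-1 by fld.
  by rewrite [al a^-1 _]al_scal // scalA // mulVf // scal1.
have := uu_w_al a0 js; rewrite wE => ->; congr (_ + _).
by rewrite al_scal // scalA // [RHS]al_scal.
Qed.

Lemma ww_basis (a : F) l : a != 0 -> j l = l -> [/\ w a l = - l,
  w a (al 1 l) = w 1 (al 1 (s (a ^- 2) l)) &
  w a (w 1 (al 1 l)) = al 1 (s (a ^+ 2) l)].
Proof.
move=> a0 jl; rewrite -!al_scal //; split; first exact: ww_H.
  by rewrite wwE' // hh_al ?invr_eq0 // mulr1 exprVn.
by rewrite wwE // wwK // hh_al // mulr1.
Qed.

(** * The isomorphism of V with Ad(2, L) *)

Section Iso.
Variable L : zmodClosed V.
Hypothesis LH : forall v, (v \in L) = (j v == v).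

Lemma H_subgrp (l : subgrp L) : j (val l) = val l.
Proof. by apply/eqP; rewrite -LH; exact: (valP l). Qed.
Hint Resolve H_subgrp : core.

Fact scal_subgrp (a : F) (l : subgrp L) : s a (val l) \in L.
Proof. by rewrite LH scal_H. Qed.

Definition H_scale (a : F) (l : subgrp L) : subgrp L := to_subgrp (scal_subgrp a l).

Fact H_scaleA a b l : H_scale a (H_scale b l) = H_scale (a * b) l.
Proof. apply: val_inj; exact: scalA. Qed.

Fact H_scale1 : left_id 1 H_scale.
Proof. move=> l; apply: val_inj; exact: scal1. Qed.

Fact H_scaleDr : right_distributive H_scale +%R.
Proof. move=> a l m; apply: val_inj; exact: scalDr. Qed.

Fact H_scaleDl l : {morph H_scale^~ l : a b / a + b}.
Proof. move=> a b; apply: val_inj; exact: scalDl. Qed.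

Definition H_vspace : vspace_on F (subgrp L) :=
  VspaceOn H_scaleA H_scale1 H_scaleDr H_scaleDl.

Definition ad_embed_fun (n : 'I_3) (l : vspace H_vspace) : V :=
  let v := val (l : subgrp L) in
  if n == 0 then v else if n == 1 then al 1 v else w 1 (al 1 v).

Fact ad_embedB n : zmod_morphism (ad_embed_fun n).
Proof.
move=> l m; rewrite /ad_embed_fun; case: ifP => // _.
have alB (x y : V) : al 1 (x - y) = al 1 x - al 1 y by rewrite raddfB /=; zmod.
have -> : val ((l - m : vspace H_vspace) : subgrp L) =
    val (l : subgrp L) - val (m : subgrp L) by [].
by case: ifP; rewrite alB // raddfB.
Qed.
HB.instance Definition _ n :=
  GRing.isZmodMorphism.Build (vspace H_vspace) V (ad_embed_fun n) (ad_embedB n).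

Definition ad_embed n : {additive vspace H_vspace -> V} := ad_embed_fun n.

Lemma al0 : al 1 (0 : V) = 0.
Proof. by rewrite raddf0 subr0. Qed.

Lemma sum_ord3 (T : zmodType) (f : 'I_3 -> T) : \sum_n f n = f 0 + f 1 + f ord_max.
Proof.
by rewrite !big_ord_recl big_ord0 addr0 addrA; congr (_ + f _ + f _); apply: val_inj.
Qed.

Lemma ad_embed_sum (x y z x' y' z' : F) (l : vspace H_vspace) :
  x = x' -> - (y / 2) = y' -> z / 2 = z' ->
  let v := val (l : subgrp L) in
  \sum_n ad_embed n (ad_coord F n (ad2 x y z) *: l) =
  s x' v + al 1 (s y' v) + w 1 (al 1 (s z' v)).
Proof. by move=> <- <- <-; rewrite sum_ord3 !ad_coordE. Qed.

Lemma scal0 l : s 0 l = 0.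
Proof. by rewrite /scal uu0 // subrr !raddf0 addr0 mul0rn. Qed.

Lemma odd_Ad_iso :
  exists2 psi : {additive V -> AdL 2 (vspace H_vspace)}, bijective psi &
  {in SL 2 F, forall A v, psi (R A v) = tensor_map (conj_act A) (psi v)}.
Proof.
have [v|x|psi bij_psi psiE] := @tensor_basis_iso F _ _ V _ (@ad_basis F)
   (@ad_coord F) ad_embed
   (ad_basis_sum nz2) (ad_basis_coord nz2).
- have [l [q [r [jl jq jr ->]]]] := H_decomp v.
  have inL m : j m = m -> m \in L by rewrite LH => /eqP.
  exists (fun n => if n == 0 then to_subgrp (inL l jl) else
     if n == 1 then to_subgrp (inL q jq) else to_subgrp (inL r jr)).
  by rewrite sum_ord3.
- rewrite sum_ord3 => /(H_indep (H_subgrp _) (H_subgrp _) (H_subgrp _))[x0 x1 x2] n.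
  by case: n => [[|[|[|//]]] ?]; apply: val_inj;
     [rewrite -[RHS]x0 | rewrite -[RHS]x1 | rewrite -[RHS]x2];
     congr (val (x _)); apply: val_inj.
exists psi => //.
have zE := (scal0, al0, raddf0 (w 1), addr0, add0r).
(* On generators, the coordinates x', y', z' of each conjugated vector of [ad_basis] are compared
   with [uu_basis] and [ww_basis]. *)
apply: SL2_ind => [a|a a0|A B SA SB psiA psiB] v.
- apply: psiE => n l; have [e0 e1 e2] := uu_basis a (H_subgrp l).
  have det1 : 1 * 1 - a * 0 = 1 :> F by ring.
  case: n => [[|[|[|//]]] ?]; rewrite /ad_basis /= conj_ad2 //.
  + rewrite (ad_embed_sum (x' := 1) (y' := a) (z' := 0) l); [|fld|fld|fld].
    by rewrite scal1 // !zE -e0.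
  + rewrite (ad_embed_sum (x' := 0) (y' := 1) (z' := 0) l); [|fld|fld|fld].
    by rewrite scal1 // !zE -e1.
  + rewrite (ad_embed_sum (x' := a + a) (y' := a ^+ 2) (z' := 1) l); [|fld|fld|fld].
    by rewrite scal1 // scalDl // -mulr2n [RHS]addrC addrA -e2.
- apply: psiE => n l; have [e0 e1 e2] := ww_basis a0 (H_subgrp l).
  have det1 : 0 * 0 - a * - a^-1 = 1 :> F by fld.
  case: n => [[|[|[|//]]] ?]; rewrite /ad_basis /= conj_ad2 //.
  + rewrite (ad_embed_sum (x' := -1) (y' := 0) (z' := 0) l); [|fld|fld|fld].
    have sN : s (-1) (val (l : subgrp L)) = - val (l : subgrp L).
      by apply/eqP; rewrite -addr_eq0 -{2}[val l]scal1 // -scalDl // addNr scal0.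
    by rewrite sN !zE -e0.
  + rewrite (ad_embed_sum (x' := 0) (y' := 0) (z' := a ^- 2) l); [|fld|fld|fld].
    by rewrite !zE -e1.
  + rewrite (ad_embed_sum (x' := 0) (y' := a ^+ 2) (z' := 0) l); [|fld|fld|fld].
    by rewrite !zE -e2.
rewrite (proj2 actR) // psiA psiB.
by apply/esym/tensor_map_comp => X; exact: conj_actM.
Qed.
End Iso.
End OddAction.

(** * Modules of dimension 3 *)

Section OddRank.
Variables (U : modular_universe) (dim : additive_dimension U) (V : zmodType).
Hypothesis OV : Ob U V.
Hypothesis connV : dim_connected dim V.
Hypothesis dimV : dim V = 3%N.
Variables (F : finFieldType) (R : {'GL_2[F]} -> {additive V -> V}).
Hypothesis actR : Defs.is_action (SL 2 F) R.
Hypothesis ArR : {in SL 2 F, forall A, Ar U (R A)}.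
Hypothesis actN1 : forall v, R (sl2 (-1) 0 0 (-1)) v = v.
Variable i : F.
Hypothesis i2 : i ^+ 2 = -1.
Hypothesis nz2 : (2 : F) != 0.
Hypothesis two_inj : forall v : V, v *+ 2 = 0 -> v = 0.
Variable k : nat.
Hypothesis quarter : forall v : V, v *+ 4 *+ k = v.

Local Notation u := (uu R).
Local Notation w := (ww R).
Local Notation j := (hh R i).

Hypothesis j_neq1 : ~ forall v, j v = v.
Variable N : nat.
Hypothesis unipotent : forall (a : F) (v : V), iter N (u a \- idfun) v = 0.

Let i_neq0 : i != 0 := sqrtN1_neq0 i2.
Hint Resolve i_neq0 : core.

(* s = -(1 + j + w_a + j w_a)/2, a unit of order 3 of the Hurwitz order *)
Local Lemma hurwitz (a : F) : a != 0 -> exists s s' : {additive V -> V},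
  [/\ Ar U s, Ar U s', cancel s s', cancel s' s &
   forall v, s (j v) = w a (s v) /\ s (w a v) = j (w a (s v))].
Proof.
move=> a0.
pose s1 := - (1 + i) / 2; pose s2 := - (a + i * a) / 2.
pose s3 := - (- a^-1 + i / a) / 2; pose s4 := - (1 - i) / 2.
have iV : i^-1 = - i by apply: (mulfI i_neq0); rewrite mulfV // mulrN -expr2 i2 opprK.
have detS : s1 * s4 - s2 * s3 = 1 by rewrite /s1 /s2 /s3 /s4; field: i2; rewrite nz2 a0.
have detS' : s4 * s1 - (- s2) * (- s3) = 1 by rewrite -detS; ring.
have det1 : 0 * 0 - a * - a^-1 = 1 by fld.
have detj : i * - i - 0 * 0 = 1 by ring: i2.
have jE v : j v = R (sl2 i 0 0 (- i)) v by apply: eq_sl2.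
exists (R (sl2 s1 s2 s3 s4)), (R (sl2 s4 (- s2) (- s3) s1)); split.
- exact: (Ar_sl2 ArR).
- exact: (Ar_sl2 ArR).
- move=> v; rewrite act_sl2M // -[RHS](proj1 actR) -sl2_1.
  by apply: eq_sl2; rewrite -?detS; ring.
- move=> v; rewrite act_sl2M // -[RHS](proj1 actR) -sl2_1.
  by apply: eq_sl2; rewrite -?detS; ring.
move=> v; rewrite !jE; split.
  rewrite act_sl2M // act_sl2M //; apply: eq_sl2; rewrite /s1 /s2 /s3 /s4;
    by field: i2; rewrite ?nz2 ?a0.
rewrite act_sl2M // act_sl2M // act_sl2M //; last by field: i2.
by apply: eq_sl2; rewrite /s1 /s2 /s3 /s4; field: i2; rewrite ?nz2 ?a0.
Qed.

(** Twice the projection onto H, written without division so that it is visibly compatible. *)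
Definition one_j : {additive V -> V} := idfun \+ j.

(** The ranks of (1 ± j)(1 ± w_a) add up to 3. The element of order 3 permutes the three nontrivial
    sign patterns, so their ranks share one value r, and r != 0 because j acts nontrivially. Hence r
    = 1 and (1 + j)(1 + w_a) has rank 0. *)
Local Lemma klein_rank (a : F) : a != 0 ->
  rk dim one_j = 1%N /\ forall v, v + j v + w a v + j (w a v) = 0.
Proof.
move=> a0.
pose mj : {additive V -> V} := idfun \- j.
pose pw : {additive V -> V} := idfun \+ w a; pose mw : {additive V -> V} := idfun \- w a.
have jw v : j (w a v) = w a (j v) by rewrite (sqrtN1_ww actR actN1 i2).
have wwv v : w a (w a v) = v by rewrite wwK.
have jj v : j (j v) = v by rewrite (sqrtN1_hhK actR actN1 i2).
have Apj : Ar U one_j := Ar_add (Ar_id OV) (Ar_hh ArR i_neq0).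
have Amj : Ar U mj := Ar_sub (Ar_id OV) (Ar_hh ArR i_neq0).
have Apw : Ar U pw := Ar_add (Ar_id OV) (Ar_ww ArR a0).
have Amw : Ar U mw := Ar_sub (Ar_id OV) (Ar_ww ArR a0).
have s1 : rk dim one_j = (rk dim (mw \o one_j) + rk dim (pw \o one_j))%N.
  apply: rk_split Apj Apw _ => b; split=> [[v <-]|[[v <-]]].
    split; first by exists (mw v); apply: (eq_lin (jw v) (n := -1)); rewrite /=; zmod.
    by apply: (eq_lin (wwv (v + j v)) (n := -1)); rewrite /=; zmod.
  have jX : j (v + j v) = v + j v by rewrite raddfD /= jj addrC.
  (* When j X = X and w X = -X, the map (1 - w)(1 + j) multiplies X by 4, so k X is a preimage of
     X. *)
  rewrite -[one_j v]/(v + j v); move: (v + j v) jX => X jX.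
  rewrite /= => e; exists (X *+ k); rewrite -[LHS]/((mw \o one_j) (X *+ k)).
  rewrite [LHS]raddfMn -[RHS]quarter; congr (_ *+ _).
  by rewrite /= jX; apply: (eq_lin e (n := -2)); zmod.
have s2 : rk dim mj = (rk dim (mw \o mj) + rk dim (pw \o mj))%N.
  apply: rk_split Amj Apw _ => b; split=> [[v <-]|[[v <-]]].
    split; first by exists (mw v); apply: (eq_lin (jw v) (n := 1)); rewrite /=; zmod.
    by apply: (eq_lin (wwv (v - j v)) (n := -1)); rewrite /=; zmod.
  have jX : j (v - j v) = - (v - j v) by rewrite raddfB /= jj opprB.
  rewrite -[mj v]/(v - j v); move: (v - j v) jX => X jX.
  rewrite /= => e; exists (X *+ k); rewrite -[LHS]/((mw \o mj) (X *+ k)).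
  rewrite [LHS]raddfMn -[RHS]quarter; congr (_ *+ _).
  by rewrite /= jX; apply: (eq_lin e (n := -2)); zmod.
have s3 : rk dim (idfun : {additive V -> V}) = (rk dim mj + rk dim (one_j \o idfun))%N.
  apply: rk_split (Ar_id OV) Apj _ => b; split=> [[v <-]|[_ /= e]].
    by split; [exists (mj v) | rewrite /= raddfB /= jj; zmod].
  (* Half of b: on the -1-eigenspace, 1 - j is multiplication by 2. *)
  exists (b *+ 2 *+ k); rewrite -[LHS]/(mj (b *+ 2 *+ k)).
  rewrite [LHS]raddfMn -[RHS]quarter; congr (_ *+ _).
  by rewrite raddfMn /=; apply: (eq_lin e (n := -2)); zmod.
have [s [s' [As As' sK s'K sE]]] := hurwitz a0.
have sj v : s (j v) = w a (s v) by case: (sE v).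
have sw v : s (w a v) = w a (j (s v)) by rewrite -jw; case: (sE v).
have swj v : s (w a (j v)) = j (s v) by rewrite sw sj jw wwv.
have c1 : rk dim (pw \o mj) = rk dim (mw \o one_j).
  apply: (rk_conj dim (Ar_comp Amw Apj) As As' sK s'K) => v.
  transitivity (s v + s (j v) - s (w a v) - s (w a (j v))); last by rewrite /=; zmod.
  by rewrite sj sw swj /=; zmod.
have c2 : rk dim (mw \o mj) = rk dim (pw \o mj).
  apply: (rk_conj dim (Ar_comp Apw Amj) As As' sK s'K) => v.
  transitivity (s v - s (j v) + s (w a v) - s (w a (j v))); last by rewrite /=; zmod.
  by rewrite sj sw swj /=; zmod.
have rid : rk dim (idfun : {additive V -> V}) = 3%N.
  by rewrite -dimV; apply: (rk_inj dim (Ar_id OV)) => x1 x2.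
have rid' : rk dim (one_j \o idfun) = rk dim one_j by apply: rk_eq.
(* If r = 0, then (1 - w)(1 - j) and (1 + w)(1 - j) both vanish, and so does their sum 2 (1 - j). *)
have r_neq0 : rk dim (mw \o one_j) != 0%N.
  apply/eqP => r0; apply: j_neq1 => v.
  have z1 := rk_eq0 connV (Ar_comp Amw Amj) (etrans c2 (etrans c1 r0)) v.
  have z2 := rk_eq0 connV (Ar_comp Apw Amj) (etrans c1 r0) v.
  apply: subr0_eq; apply: two_inj; move: z1 z2; rewrite /= => z1 z2.
  by apply: (eq_lin2 z1 z2 (n := -1) (n' := -1)); zmod.
have [r1 r0] : rk dim (mw \o one_j) = 1%N /\ rk dim (pw \o one_j) = 0%N by lia.
split; first by lia.
move=> v; have := rk_eq0 connV (Ar_comp Apw Apj) r0 v.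
by rewrite /= jw raddfD /= => e; apply: (eq_lin e (n := 1)); zmod.
Qed.

(** By [rk_nilpotent], each composition with the nilpotent x = u(a) - 1 strictly lowers a nonzero
    rank; from rank 3 this forces x^3 = 0. *)
Local Lemma cubic_rank (a : F) v :
  u a (u a (u a v)) - u a (u a v) *+ 3 + u a v *+ 3 - v = 0.
Proof.
pose x : {additive V -> V} := u a \- idfun.
have Ax : Ar U x := Ar_sub (Ar_uu ArR a) (Ar_id OV).
have xN t : iter N x t = 0 := unipotent a t.
have drop (f : {additive V -> V}) : Ar U f -> (forall t, exists t', f t' = x (f t)) ->
    rk dim (x \o f) = 0%N \/ (rk dim (x \o f) < rk dim f)%N.
  move=> Af fx; have := rk_comp dim Af Ax.
  rewrite leq_eqVlt => /predU1P[ryf|]; last by right.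
  have f0 := rk_nilpotent connV Af Ax fx (fun t => xN (f t)) ryf.
  by left; rewrite ryf rk_zero.
have Ax2 := Ar_comp Ax Ax.
have d1 := drop idfun (Ar_id OV) (fun t => ex_intro _ (x t) erefl).
have d2 := drop x Ax (fun t => ex_intro _ (x t) erefl).
have d3 := drop (x \o x) Ax2 (fun t => ex_intro _ (x t) erefl).
have r0 : rk dim (idfun : {additive V -> V}) = 3%N.
  by rewrite -dimV; apply: (rk_inj dim (Ar_id OV)) => x1 x2.
have e1 : rk dim (x \o idfun) = rk dim x by apply: rk_eq.
have l1 := rk_comp dim Ax Ax; have l2 := rk_comp dim Ax2 Ax.
rewrite {}r0 {}e1 in d1.
have r3 : rk dim (x \o (x \o x)) = 0%N.
  by move: d1 d2 d3 l1 l2; rewrite /reverse_coercion; lia.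
have := rk_eq0 connV (Ar_comp Ax Ax2) r3 v; rewrite /= => e.
by apply: (eq_lin e (n := 1)); zmod.
Qed.

(** The map y = u(a) + u(-a) - 2 commutes with j and squares to 0, so it acts nilpotently on im (1 +
    j). That image has rank 1, hence y kills it. *)
Local Lemma quadratic_rank (a : F) l : j l = l -> u a l + u (- a) l = l *+ 2.
Proof.
pose y : {additive V -> V} := (u a \+ u (- a)) \- (idfun \+ idfun).
have Ay : Ar U y := Ar_sub (Ar_add (Ar_uu ArR a) (Ar_uu ArR (- a)))
  (Ar_add (Ar_id OV) (Ar_id OV)).
have Af : Ar U one_j := Ar_add (Ar_id OV) (Ar_hh ArR i_neq0).
have jy v : j (y v) = y (j v).
  rewrite /= raddfB raddfD /= raddfD /= !(sqrtN1_uu actR i2) opprK.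
  by zmod.
have fy v : exists v', one_j v' = y (one_j v).
  by exists (y v); rewrite -[RHS]/(y (v + j v)) [RHS]raddfD -jy.
have y2 v : y (y v) = 0.
  (* As y u = (u - 1)^2, y^2 v equals (u - 1)^4 t for v = u^2 t, a difference of two instances of
     the cubic relation. *)
  pose t := u (- a) (u (- a) v).
  have -> : v = u a (u a t) by rewrite /t !uuKN.
  have e1 := cubic_rank a t; have e2 := cubic_rank a (u a t).
  have yE z : y (u a z) = u a (u a z) + z - u a z *+ 2.
    by rewrite /= uuNK // mulr2n.
  have yB : y (u a (u a t)) = u a (u a (u a t) + t - u a t *+ 2).
    by rewrite yE; zmod.
  rewrite yB yE.
  by apply: (eq_lin2 e2 e1 (n := 1) (n' := -1)); zmod.
have [r1 _] := klein_rank (oner_neq0 F).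
have yf0 : forall v, y (one_j v) = 0.
  apply: (rk_eq0 connV (Ar_comp Ay Af)); have := rk_comp dim Af Ay; rewrite r1.
  rewrite leq_eqVlt => /orP[/eqP r1'|]; last by rewrite ltnS leqn0 => /eqP.
  have f0 := rk_nilpotent (k := 2) connV Af Ay fy (fun v => y2 (one_j v))
    (etrans r1' (esym r1)).
  by move: r1; rewrite rk_zero.
move=> jl; apply: subr0_eq; apply: two_inj; have := yf0 l; rewrite /= jl => e.
by apply: (eq_lin e (n := 1)); zmod.
Qed.

(** L is presented as the image of 1 + j, so that its dimension is the rank found in [klein_rank];
    since 2 is invertible on V, it is also the fixed space of j. *)
Lemma odd_module_iso : exists L : zmodClosed V,
  [/\ Ob U (subgrp L), dim (subgrp L) = 1%N & exists s : vspace_on F (subgrp L),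
    exists2 psi : {additive V -> AdL 2 (vspace s)}, bijective psi &
    {in SL 2 F, forall A v, psi (R A v) = tensor_map (conj_act A) (psi v)}].
Proof.
have Af : Ar U one_j := Ar_add (Ar_id OV) (Ar_hh ArR i_neq0).
exists (addim one_j); split; first exact: Ob_im.
  by case: (klein_rank (oner_neq0 F)).
have LH v : (v \in addim one_j) = (j v == v).
  apply/addimP/eqP => [[t <-]|jv].
    by rewrite /= raddfD /= (sqrtN1_hhK actR actN1 i2) addrC.
  exists (v *+ 2 *+ k); rewrite [LHS]raddfMn -[RHS]quarter; congr (_ *+ _).
  by rewrite raddfMn /= jv; zmod.
have klein a v (a0 : a != 0) := proj2 (klein_rank a0) v.
exists (H_vspace actR actN1 i2 nz2 two_inj quarter klein cubic_rank quadratic_rank LH).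
exact: odd_Ad_iso.
Qed.
End OddRank.

(** * Modules of dimension 2 in characteristic 2 *)

Section Char2.
Variables (U : modular_universe) (dim : additive_dimension U) (V : zmodType).
Hypothesis OV : Ob U V.
Hypothesis connV : dim_connected dim V.
Hypothesis dimV : dim V = 2%N.
Hypothesis char2V : forall v : V, v *+ 2 = 0.

(** Let x = g - 1. If x has rank 2 it is onto, and (1 + g + g^2) x = g^3 - 1 = 0. Rank 0 means g =
    1. In rank 1, y = t - 1 has square 0 and preserves im x, so it either contradicts [rk_nilpotent]
    or kills im x. *)
Lemma dihedral_sum (g t : {additive V -> V}) : Ar U g -> Ar U t ->
  (forall v, g (g (g v)) = v) -> (forall v, t (t v) = v) ->
  (forall v, t (g v) = g (g (t v))) -> ~ (forall v, g v = v) ->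
  forall v, v + g v + g (g v) = 0.
Proof.
move=> Ag At g3 t2 tg gN1.
pose x : {additive V -> V} := g \- idfun; pose y : {additive V -> V} := t \- idfun.
have Ax : Ar U x := Ar_sub Ag (Ar_id OV); have Ay : Ar U y := Ar_sub At (Ar_id OV).
have x_neq0 : ~ forall v, x v = 0.
  by move=> x0; apply: gN1 => v; apply: subr0_eq; exact: x0.
have r2 : rk dim (idfun : {additive V -> V}) = 2%N.
  by rewrite -dimV; apply: (rk_inj dim (Ar_id OV)) => ? ?.
have rx : (rk dim x <= 2)%N.
  have <- : rk dim (x \o idfun) = rk dim x by apply: rk_eq.
  by rewrite -r2; exact: (rk_comp dim (Ar_id OV) Ax).
have yx v : exists w, x w = y (x v).
  (* From t g = g^2 t: (t - 1)(g - 1) = (g^2 - 1) t - (g - 1) = (g - 1)(g t + t - 1). *)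
  by exists (g (t v) + t v - v); apply: (eq_lin (tg v) (n := -1)); rewrite /=; zmod.
have y2 v : iter 2 y (x v) = 0.
  apply: (eq_lin2 (t2 (g v - v)) (char2V (g v - v - t (g v - v)))
    (n := 1) (n' := 1)).
  by rewrite /=; zmod.
have : rk dim x != 1%N.
  apply/eqP => rx1; have := rk_comp dim Ax Ay; rewrite rx1 leq_eqVlt => /predU1P[ry|].
    by apply: x_neq0; apply: (rk_nilpotent connV Ax Ay yx y2); rewrite rx1.
  rewrite ltnS leqn0 => /eqP/(rk_eq0 connV (Ar_comp Ay Ax)) tx.
  (* Now t fixes im x pointwise, so t g = g^2 t gives g = g^2 there, that is g = 1 on im x. Thus (g
     - 1)^2 = 0, which in characteristic 2 means g^2 = 1; with g^3 = 1 this gives g = 1. *)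
  have {}tx v : t (g v - v) = g v - v by apply: subr0_eq; exact: tx.
  apply: gN1 => v.
  have e1 : t (g (g v - v)) = g (g v - v) by rewrite raddfB.
  rewrite tg tx in e1.
  have e2 : g (g v - v) = g v - v by have := congr1 g e1; rewrite g3 e1.
  have e3 : g (g v) = v.
    by apply: (eq_lin2 e2 (char2V (g v - v)) (n := 1) (n' := 1)); zmod.
  by rewrite -[RHS]g3 e3.
move=> rx1 v; case: (posnP (rk dim x)) => [/(rk_eq0 connV Ax)//|r_gt0].
have : rk dim x = dim V by rewrite dimV; lia.
move=> /(rk_surj connV Ax)/(_ v)[w <-].
by apply: (eq_lin (g3 w) (n := 1)); rewrite /=; zmod.
Qed.

Variables (F : finFieldType) (R : {'GL_2[F]} -> {additive V -> V}).
Hypothesis cardF : #|F| = 4%N.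
Hypothesis actR : Defs.is_action (SL 2 F) R.
Hypothesis ArR : {in SL 2 F, forall A, Ar U (R A)}.
Hypothesis faithful : {in SL 2 F, forall A, (forall v, R A v = v) -> A = 1%g}.

Local Notation u := (uu R).
Local Notation w := (ww R).
Local Notation h := (hh R).

Lemma F4_oppr (a : F) : - a = a.
Proof.
have ch2 : 2 \in [pchar F] by apply: (@card_finPcharP _ _ 2).
exact: oppr_pchar2.
Qed.

Lemma F4_cube (a : F) : a != 0 -> a ^+ 3 = 1.
Proof. by move=> a0; apply: (mulfI a0); rewrite mulr1 -exprS -cardF expf_card. Qed.

Lemma F4_quad (a : F) : a != 0 -> a != 1 -> a ^+ 2 = a + 1.
Proof.
move=> a0 a1; have a1' : a - 1 != 0 by rewrite subr_eq0.
have : a ^+ 2 + a + 1 = 0.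
  by apply: (mulfI a1'); rewrite mulr0; transitivity (a ^+ 3 - 1);
    [ring | rewrite F4_cube // subrr].
by move=> e; rewrite -[RHS]F4_oppr; apply/eqP; rewrite -subr_eq0 opprK addrA e.
Qed.

Lemma uu_two (a : F) v : u a (u a v) = v.
Proof. by rewrite -{1}[a]F4_oppr uuNK. Qed.

Lemma actN1_two v : R (sl2 (-1) 0 0 (-1)) v = v.
Proof. by rewrite F4_oppr sl2_1 (proj1 actR). Qed.

Lemma two_opp (v : V) : - v = v.
Proof. by apply: (eq_lin (char2V v) (n := -1)); zmod. Qed.

Lemma act_nontrivial (a b c d : F) : a * d - b * c = 1 ->
  (forall v, R (sl2 a b c d) v = v) -> a = 1 /\ b = 0.
Proof.
move=> det1 /(faithful (sl2_SL det1)) /(congr1 (@GLval 2 F)).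
rewrite val_sl2 // GL_1E => /matrixP e.
by have := e 0 0; have := e 0 1; rewrite !mxE.
Qed.

(** diag(c, 1/c) has order 3 and is inverted by the involution w_1. *)
Lemma torus_sum (c : F) v : c != 0 -> c != 1 -> v + h c v + h c (h c v) = 0.
Proof.
move=> c0 c1; have c2 := F4_cube c0.
apply: (dihedral_sum (Ar_hh ArR c0) (Ar_ww ArR (oner_neq0 F))) => [x|x|x|e].
- by rewrite !hhM ?mulf_neq0 // -expr2 -exprSr c2 hh1.
- by rewrite (wwK actR actN1_two) ?oner_neq0.
- have -> : h c x = h (c^-1 ^-1) x by rewrite invrK.
  rewrite -wwE' ?invr_eq0 // wwE ?invr_eq0 // hhM // -expr2.
  by congr (h _ _); apply: (mulIf c0); rewrite mulVf // -exprSr c2.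
have [|/eqP] := act_nontrivial _ e; first by fld.
by rewrite (negPf c1).
Qed.

Lemma ww_two (a : F) v : a != 0 -> w a (w a v) = v.
Proof. exact: (wwK actR actN1_two). Qed.

(** u(a) and w_a act as involutions with u w u = w u w, so their product has order 3 and is inverted
    by w_a. *)
Lemma uw_sum (a : F) v : a != 0 -> v + u a (w a v) + w a (u a v) = 0.
Proof.
move=> a0; pose g : {additive V -> V} := u a \o w a.
have gg x : g (g x) = w a (u a x).
  have := uu_ww_uu actR (w a x) a0; rewrite F4_oppr ww_two // => <-.
rewrite -gg; have -> : u a (w a v) = g v by [].
apply: (dihedral_sum (Ar_comp (Ar_uu ArR a) (Ar_ww ArR a0)) (Ar_ww ArR a0)) => [x|x|x|e].
- by rewrite gg /= uu_two ww_two.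
- exact: ww_two.
- by rewrite gg.
suff : a = 0 by apply/eqP.
have det1 : 1 * 1 - a * 0 = 1 :> F by ring.
have det1' : 0 * 0 - a * - a^-1 = 1 :> F by fld.
have [||_] := @act_nontrivial (1 * 0 + a * - a^-1) (1 * a + a * 0)
  (0 * 0 + 1 * - a^-1) (0 * a + 1 * 0).
- by fld.
- by move=> x; rewrite -act_sl2M //; exact: e.
by rewrite mul1r mulr0 addr0.
Qed.

(** Write h for h(c). Conjugating 1 + h + h^2 = 0 by u(c) gives l + h l + h u(1) h l = 0. Comparison
    with the relation at l shows that u(1) fixes h l, and h u(c) = u(c^3) h = u(1) h. *)
Lemma uu_fix (c : F) l : u 1 l = l -> u c l = l.
Proof.
move=> ul; have [->|c0] := eqVneq c 0; first by rewrite uu0.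
have [->//|c1] := eqVneq c 1.
have c2 := F4_quad c0 c1; have c3 := F4_cube c0.
have hu a x : h c (u a x) = u (c ^+ 2 * a) (h c x) by rewrite hh_uu.
(* h u_1 is the conjugate of h by u_c *)
have conj x : h c (u 1 x) = u c (h c (u c x)).
  by rewrite !hu uuD // -exprSr c3 c2 mulr1.
have e := torus_sum (u c l) c0 c1.
have hl : h c l = u c (h c (u c l)) by rewrite -conj ul.
have hul : h c (u 1 (h c l)) = u c (h c (h c (u c l))).
  by rewrite conj {1}hl uu_two.
have e1 : l + h c l + h c (u 1 (h c l)) = 0.
  by have := congr1 (u c) e; rewrite raddf0 raddfD /= raddfD /= uu_two -hl -hul.
have e2 : h c (u 1 (h c l)) = h c (h c l).
  by apply: (eq_lin2 e1 (torus_sum l c0 c1) (n := 1) (n' := -1)); zmod.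
have hinj : injective (h c).
  apply: (@can_inj _ _ _ (h c^-1)) => x.
  by rewrite hhM ?invr_eq0 // mulVf // hh1.
have {}e2 := hinj _ _ e2.
apply: hinj; rewrite hu -exprSr c3 //.
Qed.

(** Zero is treated apart because [sl2] takes its default value 1 there, so [h 0] would be the
    identity. *)
Definition torus_scal (a : F) (l : V) : V := if a == 0 then 0 else h a l.
Local Notation s := torus_scal.

Lemma torus_scalA (a b : F) l : s a (s b l) = s (a * b) l.
Proof.
rewrite /s mulf_eq0; case: eqP => //= /eqP a0; case: eqP => /= [_|/eqP b0].
  exact: raddf0.
exact: hhM.
Qed.

Lemma torus_scalDr (a : F) l m : s a (l + m) = s a l + s a m.
Proof. by rewrite /s; case: eqP; rewrite ?addr0 // raddfD. Qed.

Lemma torus_scal0 l : s 0 l = 0.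
Proof. by rewrite /s eqxx. Qed.

Lemma torus_scalE (a : F) l : a != 0 -> s a l = h a l.
Proof. by rewrite /s => /negPf->. Qed.

Lemma torus_scal1 l : s 1 l = l.
Proof. by rewrite /s oner_eq0 hh1. Qed.

(** For distinct nonzero a and b = c a, the relation c^2 = c + 1 gives a + b = c^2 a, so additivity
    amounts to 1 + h(c) + h(c)^2 = 0 in characteristic 2. *)
Lemma torus_scalDl (a b : F) l : s (a + b) l = s a l + s b l.
Proof.
have [->|a0] := eqVneq a 0; first by rewrite /s eqxx !add0r.
have [->|ab] := eqVneq b a.
  by rewrite -{2}[a]F4_oppr subrr {1}/s eqxx -mulr2n char2V.
have [->|b0] := eqVneq b 0; first by rewrite {3}/s eqxx !addr0.
have [c bE] : exists c, b = c * a by exists (b / a); rewrite divfK.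
have c0 : c != 0 by apply: contra b0 => /eqP c0; rewrite bE c0 mul0r.
have c1 : c != 1 by apply: contra ab => /eqP c1; rewrite bE c1 mul1r.
have -> : a + b = c ^+ 2 * a by rewrite bE F4_quad // mulrDl mul1r addrC.
have sE x m : x != 0 -> s x m = h x m by rewrite /s => /negPf->.
rewrite bE -(torus_scalA (c ^+ 2)) -(torus_scalA c a); move: (s a l) => m.
rewrite !sE ?expf_neq0 // expr2 -hhM //.
by rewrite -[LHS]two_opp; apply: (eq_lin (torus_sum m c0 c1) (n := -1)); zmod.
Qed.

Definition u_defect : {additive V -> V} := u 1 \- idfun.

Lemma Ar_u_defect : Ar U u_defect.
Proof. exact: Ar_sub (Ar_uu ArR 1) (Ar_id OV). Qed.

(** One inclusion is (u - 1)^2 = 0. Conversely, if u v = v then [uw_sum] reads v + u w v + w v = 0,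
    so v = (u - 1) w v. By additivity the fixed space then has dimension 1. *)
Lemma u_defect_exact : addim u_defect =i addker u_defect.
Proof.
move=> v; rewrite addkerP; apply/addimP/eqP => [[x <-]|xv].
  apply: (eq_lin2 (uu_two 1 x) (char2V (x - u 1 x)) (n := 1) (n' := 1)).
  by rewrite /=; zmod.
have uv : u 1 v = v by apply: subr0_eq.
exists (w 1 v); have := uw_sum v (oner_neq0 F); rewrite uv => e.
by apply: (eq_lin2 e (char2V (v + w 1 v)) (n := 1) (n' := -1)); rewrite /=; zmod.
Qed.

Lemma dim_u_fix : dim (subgrp (addker u_defect)) = 1%N.
Proof.
have := dim_additive dim Ar_u_defect; rewrite (eq_zmodClosed u_defect_exact) dimV.
by lia.
Qed.

Local Notation L := (addker u_defect).

Lemma u_fixP (l : subgrp L) (c : F) : u c (val l) = val l.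
Proof. by apply: uu_fix; apply: subr0_eq; apply/eqP/(valP l). Qed.

Fact torus_scal_subgrp (a : F) (l : subgrp L) : s a (val l) \in L.
Proof.
rewrite addkerP /s; case: (eqVneq a 0) => [_|a0]; first by rewrite raddf0.
rewrite /= -{2}[val l](u_fixP l (a ^- 2)) hh_uu // mulfV ?subrr //.
by rewrite expf_neq0.
Qed.

Definition L_scale (a : F) (l : subgrp L) : subgrp L := to_subgrp (torus_scal_subgrp a l).

Fact L_scaleA a b l : L_scale a (L_scale b l) = L_scale (a * b) l.
Proof. apply: val_inj; exact: torus_scalA. Qed.

Fact L_scale1 : left_id 1 L_scale.
Proof. move=> l; apply: val_inj; exact: torus_scal1. Qed.

Fact L_scaleDr : right_distributive L_scale +%R.
Proof. move=> a l m; apply: val_inj; exact: torus_scalDr. Qed.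

Fact L_scaleDl l : {morph L_scale^~ l : a b / a + b}.
Proof. move=> a b; apply: val_inj; exact: torus_scalDl. Qed.

Definition L_vspace : vspace_on F (subgrp L) :=
  VspaceOn L_scaleA L_scale1 L_scaleDr L_scaleDl.

Definition nat_embed_fun (n : 'I_2) (l : vspace L_vspace) : V :=
  let v := val (l : subgrp L) in if n == 0 then v else w 1 v.

Fact nat_embedB n : zmod_morphism (nat_embed_fun n).
Proof.
move=> l m; rewrite /nat_embed_fun.
have -> : val ((l - m : vspace L_vspace) : subgrp L) =
    val (l : subgrp L) - val (m : subgrp L) by [].
by case: ifP => // _; rewrite raddfB.
Qed.
HB.instance Definition _ n :=
  GRing.isZmodMorphism.Build (vspace L_vspace) V (nat_embed_fun n) (nat_embedB n).

Definition nat_embed n : {additive vspace L_vspace -> V} := nat_embed_fun n.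

Definition nat_coord_fun (n : 'I_2) (m : Nat 2 F) : F := m n 0.
Fact nat_coord_scalar n : scalar (nat_coord_fun n).
Proof. by move=> a m m'; rewrite /nat_coord_fun !mxE. Qed.
HB.instance Definition _ n :=
  GRing.isLinear.Build F (Nat 2 F) F _ (nat_coord_fun n) (nat_coord_scalar n).
Definition nat_coord (n : 'I_2) : {scalar Nat 2 F} := nat_coord_fun n.

Definition nat_basis (n : 'I_2) : Nat 2 F := delta_mx n 0.

Lemma nat_coord_act (a b c d : F) p n : a * d - b * c = 1 ->
  nat_coord p (Nat_act (sl2 a b c d) (nat_basis n)) = mx2 a b c d p n.
Proof.
move=> det1; rewrite /nat_coord /= /nat_coord_fun /Nat_act /= val_sl2 //.
by rewrite -colE mxE.
Qed.

Lemma sum_ord2 (T : zmodType) (f : 'I_2 -> T) : \sum_n f n = f 0 + f 1.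
Proof. by rewrite !big_ord_recl big_ord0 addr0; congr (_ + f _); apply: val_inj. Qed.

(** On L, u - 1 vanishes and (u - 1) w is the identity. The decomposition V = L + w L is therefore
    explicit: the w-component of v comes from (u - 1) v. *)
Lemma char2_Nat_iso :
  exists2 psi : {additive V -> NatL 2 (vspace L_vspace)}, bijective psi &
  {in SL 2 F, forall A v, psi (R A v) = tensor_map (Nat_act A) (psi v)}.
Proof.
have basis_sum (m : Nat 2 F) : m = \sum_n nat_coord n m *: nat_basis n.
  rewrite {1}[m]matrix_sum_delta; apply: eq_bigr => n _.
  by rewrite big_ord1.
have basis_coord p n : nat_coord p (nat_basis n) = (p == n)%:R.
  by rewrite /nat_coord /= /nat_coord_fun mxE eqxx andbT.
have fixE (m : subgrp L) : u_defect (val m) = 0 by apply/eqP/(valP m).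
have defw (m : subgrp L) : u_defect (w 1 (val m)) = val m.
  have := uw_sum (val m) (oner_neq0 F); rewrite u_fixP => e.
  apply: (eq_lin2 e (char2V (val m + w 1 (val m))) (n := 1) (n' := -1)).
  by rewrite /=; zmod.
have [v|x|psi bij_psi psiE] := @tensor_basis_iso F _ _ V _ nat_basis nat_coord nat_embed
   basis_sum basis_coord.
- have qL : u_defect v \in L by rewrite -u_defect_exact; apply/addimP; exists v.
  have lL : v - w 1 (u_defect v) \in L.
    by rewrite addkerP raddfB (defw (to_subgrp qL)) subrr.
  exists (fun n => if n == 0 then to_subgrp lL else to_subgrp qL).
  by rewrite sum_ord2 /= /nat_embed_fun /= subrK.
- rewrite sum_ord2 => e.
  have {}e : val (x 0 : subgrp L) + w 1 (val (x 1 : subgrp L)) = 0 := e.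
  have wE : w 1 (val (x 1 : subgrp L)) = - val (x 0 : subgrp L).
    by apply/eqP; rewrite -addr_eq0 addrC e.
  have x1 : val (x 1 : subgrp L) = 0.
    by rewrite -[LHS]defw wE raddfN fixE oppr0.
  have x0 : val (x 0 : subgrp L) = 0 by move: e; rewrite x1 raddf0 addr0.
  by move=> n; case: (ord2_case n) => ->; apply: val_inj.
exists psi => //.
apply: SL2_ind => [a|a a0|A B SA SB psiA psiB] v.
- have det1 : 1 * 1 - a * 0 = 1 :> F by ring.
  apply: psiE => n l; rewrite sum_ord2 !nat_coord_act // !mxE.
  have embE x y : nat_embed 0 (x *: l) + nat_embed 1 (y *: l) =
    s x (val (l : subgrp L)) + w 1 (s y (val (l : subgrp L))) by [].
  rewrite embE; case: (ord2_case n) => -> /=.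
    by rewrite torus_scal1 torus_scal0 raddf0 addr0; exact: u_fixP.
  rewrite torus_scal1 -[LHS]/(u a (w 1 (val (l : subgrp L)))).
  have [->|a0] := eqVneq a 0; first by rewrite uu0 // torus_scal0 add0r.
  (* At a l this gives the action of u(a) on w_1 l, because w_a (a l) = w_1 l and u(a) fixes a l. *)
  have := uw_sum (s a (val (l : subgrp L))) a0.
  have -> : w a (u a (s a (val (l : subgrp L)))) = w 1 (val (l : subgrp L)).
    have -> : u a (s a (val (l : subgrp L))) = s a (val (l : subgrp L)).
      exact: u_fixP (L_scale a l) a.
    rewrite wwE' // torus_scalE // hhM ?invr_eq0 //.
    by rewrite mulVf // hh1.
  have -> : w a (s a (val (l : subgrp L))) = w 1 (val (l : subgrp L)).
    by rewrite wwE' // torus_scalE // hhM ?invr_eq0 // mulVf // hh1.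
  by move=> e; rewrite -[RHS]two_opp; apply: (eq_lin e (n := 1)); zmod.
- have det1 : 0 * 0 - a * - a^-1 = 1 :> F by fld.
  apply: psiE => n l; rewrite sum_ord2 !nat_coord_act // !mxE.
  have embE x y : nat_embed 0 (x *: l) + nat_embed 1 (y *: l) =
    s x (val (l : subgrp L)) + w 1 (s y (val (l : subgrp L))) by [].
  rewrite embE; case: (ord2_case n) => -> /=.
    rewrite -[LHS]/(w a (val (l : subgrp L))) torus_scal0 add0r F4_oppr.
    by rewrite torus_scalE ?invr_eq0 // wwE'.
  rewrite torus_scal0 raddf0 addr0 torus_scalE // -[LHS]/(w a (w 1 (val (l : subgrp L)))).
  by rewrite wwE // ww_two ?oner_eq0.
rewrite (proj2 actR) // psiA psiB.
apply/esym/tensor_map_comp => X.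
by rewrite -[LHS]/(GLval (mulg A B) *m X) GL_MxE -mulmxA.
Qed.

End Char2.

(** * From the isomorphism to an action of SL(2, F) *)

(** The polynomial X^(2m) - 1 cannot vanish at all 4m nonzero elements. For a nonroot a, a^(4m) = 1
    forces a^(2m) = -1, and i = a^m. *)
Lemma exists_sqrtN1 (F : finFieldType) (m : nat) : #|F| = (4 * m).+1%N ->
  exists i : F, i ^+ 2 = -1.
Proof.
move=> cardF; have m_gt0 : (0 < m)%N.
  by have := finNzRing_gt1 F; rewrite cardF ltnS; case: m {cardF}.
have [a /andP[a0 a1]] : exists a : F, (a != 0) && (a ^+ (2 * m) != 1).
  apply/existsP/contraT; rewrite negb_exists => /forallP all1.
  pose p : {poly F} := 'X^(2 * m) - 1.
  have sz_p : size p = (2 * m).+1 by rewrite size_XnsubC ?muln_gt0.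
  have p0 : p != 0 by rewrite -size_poly_eq0 sz_p.
  have := max_poly_roots (rs := enum (predC1 (0 : F))) p0 _ (enum_uniq _).
  rewrite -cardE cardC1 cardF sz_p => /(_ _)/wrap[|]; last by lia.
  apply/allP => x; rewrite mem_enum => x0; rewrite rootE !hornerE subr_eq0.
  by have := all1 x; rewrite (x0 : x != 0) negbK.
exists (a ^+ m); rewrite -exprM mulnC; apply/eqP; rewrite -addr_eq0.
have /eqP : (a ^+ (2 * m) - 1) * (a ^+ (2 * m) + 1) = 0.
  rewrite -subr_sqr expr1n -exprM; apply: (mulfI a0).
  rewrite mulr0 mulrBr mulr1 -exprS (_ : (2 * m * 2).+1 = #|F|) ?expf_card ?subrr //.
  by rewrite cardF; lia.
by rewrite mulf_eq0 subr_eq0 (negPf a1).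
Qed.

Lemma mulrn_mod (A : zmodType) (p n : nat) (v : A) : v *+ p = 0 -> v *+ n = v *+ (n %% p).
Proof.
by move=> vp; rewrite {1}(divn_eq n p) mulrnDr mulnC mulrnA vp mul0rn add0r.
Qed.

Section NatModule.
Variables (gT : finGroupType) (G : {group gT}) (F : finFieldType).
Variable phi : {morphism G >-> {'GL_2[F]}}.
Hypothesis isoG : isom G (SL 2 F) phi.
Hypothesis cardF : #|F| = 4%N.
Variable V : Mod G 2 2.
Hypothesis faithV : faithful_module V.

Lemma module_Nat : exists L : zmodClosed V,
  [/\ Ob (univ V) (subgrp L), udim V (subgrp L) = 1%N
    & exists s : vspace_on F (subgrp L),
        gmod_iso G (mod_act V) (fun g => NatL_act (vspace s) (phi g))].
Proof.
have [injf imf] := isomP isoG.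
pose R (A : {'GL_2[F]}) := mod_act V (invm injf A).
have [act1 actM] := mod_act_action V.
have inG A : A \in SL 2 F -> invm injf A \in G.
  by rewrite -imf => /morphimP[g _ Gg ->]; rewrite invmE.
have actR : Defs.is_action (SL 2 F) R.
  split=> [v|A B SA SB v]; first by rewrite /R morph1 act1.
  by rewrite /R morphM ?imf // actM ?inG.
have ArR : {in SL 2 F, forall A, Ar (univ V) (R A)}.
  by move=> A SA; apply/mod_act_Ar/inG.
have faithR : {in SL 2 F, forall A, (forall v, R A v = v) -> A = 1%g}.
  move=> A SA /(faithV (inG A SA)) e.
  have := congr1 phi e; rewrite morph1 invmK //.
  by rewrite imf.
have chV v := mod_char (m := V) v.
have connV := @mod_connected _ _ _ _ V.
have dL := dim_u_fix (mcarrier_Ob V) connV (mod_dim V) chV cardF actR ArR faithR.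
have [psi bij_psi psiE] := char2_Nat_iso (mcarrier_Ob V) connV (mod_dim V)
  chV cardF actR ArR faithR.
eexists; split; [|exact: dL|].
  by apply: Ob_ker; apply: (Ar_u_defect (mcarrier_Ob V) ArR).
eexists; exists psi => // g Gg v.
rewrite -[RHS]psiE; first by rewrite /R invmE.
by rewrite -imf mem_morphim.
Qed.
End NatModule.

Section AdModule.
Variables (gT : finGroupType) (G : {group gT}) (F : finFieldType).
Variable phi : {morphism G >-> coset_of 'Z(SL 2 F)}.
Hypothesis isoG : isom G (PSL 2 F) phi.
Variables (p : nat) (V : Mod G 3 p).
Hypothesis faithV : faithful_module V.
Variable m : nat.
Hypothesis cardF : #|F| = (4 * m).+1%N.
Hypothesis charF : p \in [pchar F].
Variable k : nat.
Hypothesis quarter : (4 * k = 1 %[mod p])%N.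
Hypothesis unipotent : forall f : {additive V -> V},
  (forall v, iter p f v = v) -> forall v, iter p (f \- idfun) v = 0.

(** The action is pulled back to SL(2, F) along the quotient map, so that central elements act
    trivially; [PSL_act_coset] takes the result back to PSL(2, F). *)
Lemma module_Ad : exists L : zmodClosed V,
  [/\ Ob (univ V) (subgrp L), udim V (subgrp L) = 1%N
    & exists s : vspace_on F (subgrp L),
        gmod_iso G (mod_act V) (fun g => AdL_act (vspace s) (phi g))].
Proof.
have [injf imf] := isomP isoG.
pose Z := 'Z(SL 2 F)%g.
have nZ A : A \in SL 2 F -> A \in 'N(Z)%g by apply: subsetP; exact: gFnorm.
pose R (A : {'GL_2[F]}) := mod_act V (invm injf (coset Z A)).
have [act1 actM] := mod_act_action V.
have inP A : A \in SL 2 F -> (coset Z A \in phi @* G)%g.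
  by move=> SA; rewrite imf; exact: mem_quotient.
have inG A : A \in SL 2 F -> invm injf (coset Z A) \in G.
  by move=> /inP/morphimP[g _ Gg ->]; rewrite invmE.
have actR : Defs.is_action (SL 2 F) R.
  split=> [v|A B SA SB v]; first by rewrite /R !morph1 act1.
  by rewrite /R morphM ?nZ // morphM ?inP // actM ?inG.
have ArR : {in SL 2 F, forall A, Ar (univ V) (R A)}.
  by move=> A SA; apply/mod_act_Ar/inG.
have [i i2] := exists_sqrtN1 cardF.
have quarterV (v : V) : v *+ 4 *+ k = v.
  by rewrite -mulrnA (mulrn_mod _ (mod_char v)) quarter -(mulrn_mod _ (mod_char v)).
have two_inj (v : V) : v *+ 2 = 0 -> v = 0.
  by move=> v2; rewrite -[v]quarterV (mulrnA v 2 2) v2 !mul0rn.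
have nz2 : (2 : F) != 0.
  apply/eqP => F2; have : (4 * k)%N%:R = 1 :> F.
    have F1 : 1 *+ p = 0 :> F := pcharf0 charF.
    by rewrite (mulrn_mod _ F1) quarter -(mulrn_mod _ F1).
  by rewrite natrM (natrM _ 2 2) F2 !mul0r => /esym/eqP; rewrite oner_eq0.
have actN1 v : R (sl2 (-1) 0 0 (-1)) v = v.
  have det1 : (-1) * (-1) - 0 * 0 = 1 :> F by ring.
  suff ZN1 : sl2 (-1 : F) 0 0 (-1) \in Z by rewrite /R coset_id // morph1 act1.
  apply/centerP; split=> [|A /SL_sl2[a [b [c [d [detA ->]]]]]]; first exact: sl2_SL.
  by rewrite /commute !sl2M //; congr sl2; ring.
have deth : i * i^-1 - 0 * 0 = 1 by rewrite mulr0 subr0 mulfV // (sqrtN1_neq0 i2).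
(* By faithfulness a trivial j would make diag(i, 1/i) central, hence scalar, so i^2 = 1, against
   i^2 = -1 and 2 != 0. *)
have j_neq1 : ~ forall v, hh R i v = v.
  move=> /(faithV (inG _ (sl2_SL deth))) e.
  have := congr1 phi e; rewrite morph1 invmK ?inP ?sl2_SL // => /coset_idr.
  move=> /(_ (nZ _ (sl2_SL deth)))/SL_center_scalar[z].
  rewrite val_sl2 // => /matrixP zE; have := zE 0 0; have := zE 1 1.
  rewrite !mxE /= => zi zi'; have : i ^+ 2 = 1.
    by rewrite expr2 {2}zi' -zi mulfV // (sqrtN1_neq0 i2).
  rewrite i2 => /esym/eqP; rewrite -addr_eq0 -[1 + 1]/(2%:R); exact/negP.
have unipR (a : F) v : iter p (uu R a \- idfun) v = 0.
  apply: unipotent => x.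
  by rewrite (iter_uu actR) -mulr_natr (pcharf0 charF) mulr0 (uu0 actR).
have [L [OL dL [s [psi bij_psi psiE]]]] := odd_module_iso (mcarrier_Ob V)
  (@mod_connected _ _ _ _ V) (mod_dim V) actR ArR actN1 i2 nz2 two_inj quarterV
  j_neq1 unipR.
exists L; split; [exact: OL | exact: dL | exists s].
exists psi; first exact: bij_psi.
move=> g Gg v.
have : phi g \in PSL 2 F by rewrite -imf mem_morphim.
case/morphimP => A _ SA phiE.
have -> : mod_act V g v = R A v by rewrite /R -phiE invmE.
rewrite (psiE A SA) phiE; apply: eq_tensor_map => X.
by rewrite PSL_act_coset.
Qed.
End AdModule.

Lemma unipotent3 (V : zmodType) (f : {additive V -> V}) : (forall v : V, v *+ 3 = 0) ->
  (forall v, iter 3 f v = v) -> forall v, iter 3 (f \- idfun) v = 0.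
Proof.
move=> V3 f3 v; apply: (eq_lin2 (f3 v) (V3 (f v - f (f v))) (n := 1) (n' := 1)).
by rewrite /=; zmod.
Qed.

Lemma unipotent5 (V : zmodType) (f : {additive V -> V}) : (forall v : V, v *+ 5 = 0) ->
  (forall v, iter 5 f v = v) -> forall v, iter 5 (f \- idfun) v = 0.
Proof.
move=> V5 f5 v.
(* 5 t collects the middle binomial terms of (f - 1)^5. *)
pose t := f v - f (f v) *+ 2 + f (f (f v)) *+ 2 - f (f (f (f v))).
apply: (eq_lin2 (f5 v) (V5 t) (n := 1) (n' := 1)).
by rewrite /t /=; zmod.
Qed.

Local Close Scope quotient_scope.
Local Close Scope ring_scope.
Local Open Scope group_scope.

Theorem theorem2 :
  (forall (F : finFieldType) (phi : {morphism 'Alt_('I_5) >-> {'GL_2[F]}}),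
     #|F| = 4 -> isom 'Alt_('I_5) (SL 2 F) phi ->
   forall V : Mod 'Alt_('I_5) 2 2, faithful_module V ->
   exists L : zmodClosed V,
     [/\ Ob (univ V) (subgrp L), udim V (subgrp L) = 1%N
       & exists s : vspace_on F (subgrp L),
           gmod_iso 'Alt_('I_5) (mod_act V)
             (fun g => NatL_act (vspace s) (phi g))])
  /\
  (forall (F : finFieldType)
     (phi : {morphism 'Alt_('I_5) >-> coset_of 'Z(SL 2 F)}),
     #|F| = 5 -> isom 'Alt_('I_5) (PSL 2 F) phi ->
   forall V : Mod 'Alt_('I_5) 3 5, faithful_module V ->
   exists L : zmodClosed V,
     [/\ Ob (univ V) (subgrp L), udim V (subgrp L) = 1%N
       & exists s : vspace_on F (subgrp L),
           gmod_iso 'Alt_('I_5) (mod_act V)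
             (fun g => AdL_act (vspace s) (phi g))])
  /\
  (forall (F : finFieldType)
     (phi : {morphism 'Alt_('I_6) >-> coset_of 'Z(SL 2 F)}),
     #|F| = 9 -> isom 'Alt_('I_6) (PSL 2 F) phi ->
   forall V : Mod 'Alt_('I_6) 3 3, faithful_module V ->
   exists L : zmodClosed V,
     [/\ Ob (univ V) (subgrp L), udim V (subgrp L) = 1%N
       & exists s : vspace_on F (subgrp L),
           gmod_iso 'Alt_('I_6) (mod_act V)
             (fun g => AdL_act (vspace s) (phi g))]).
Proof.
split; [|split].
- by move=> F phi cardF isoG V faithV; exact: module_Nat.
- move=> F phi cardF isoG V faithV.
  have charF : 5 \in [pchar F]%R by apply: (@card_finPcharP _ _ 1).
  (* 5 = 4 * 1 + 1, and 4 is the inverse of 4 modulo 5. *)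
  apply: (module_Ad isoG faithV (m := 1) (k := 4) cardF charF) => // f.
  exact/unipotent5/mod_char.
- move=> F phi cardF isoG V faithV.
  have charF : 3 \in [pchar F]%R by apply: (@card_finPcharP _ _ 2).
  (* 9 = 4 * 2 + 1, and 4 is 1 modulo 3. *)
  apply: (module_Ad isoG faithV (m := 2) (k := 1) cardF charF) => // f.
  exact/unipotent3/mod_char.
Qed.
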